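(* Let $(X,d,\mu)$ be a reverse doubling space. Given $0<\eta<1$, let $p(\cdot):X\to[1,+\infty)$ be a measurable function such that $p(\cdot)\in LH$ and $1<p_-\leq p_+<1/\eta$. Define $q(\cdot)$ by $1/p(\cdot)-1/q(\cdot)=\eta$. Then there exists $C=C(p(\cdot),\eta,X)$ such that for all $f\in L^{p(\cdot)}(X)$, $$\|I_\eta f\|_{q(\cdot)}\leq C\|f\|_{p(\cdot)}.$$ Moreover, if $\mu(X)<+\infty$, the hypothesis $p(\cdot)\in LH$ can be replaced by $1/p(\cdot)\in LH_0$.
   Context: A quasi-metric space $(X,d)$ is a set $X$ with $d:X\times X\to[0,\infty)$ such that $d(x,y)=0$ iff $x=y$, $d(x,y)=d(y,x)$, and $d(x,y)\le A_0(d(x,z)+d(y,z))$ for all $x,y,z$ and some constant $A_0\ge1$. Write $B(x,r)$ for the ball with center $x$ and radius $r$. $(X,d,\mu)$ is a space of homogeneous type if $(X,d)$ is a quasi-metric space, $\mu$ is a positive measure defined on the $\sigma$-algebra generated by quasi-metric balls and open sets, $0<\mu(B)<\infty$ for every ball $B$, and there is $C_\mu\ge1$ with $\mu(B(x,2r))\le C_\mu\,\mu(B(x,r))$ for all $x\in X$, $r>0$. A reverse doubling space is a space of homogeneous type for which there is a constant $0<\gamma<1$ such that $\mu(B(x,r/2))\le\gamma\,\mu(B(x,r))$ for every $x\in X$ and $r>0$ with $B(x,r)\subsetneq X$. Fractional integral operator: for $0<\eta<1$, $$I_\eta f(x)=\int_X\frac{f(y)}{\mu\big(B(x,d(x,y))\big)^{1-\eta}}\,d\mu(y).$$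 Variable Lebesgue spaces: for measurable $p(\cdot):X\to[1,\infty]$ let $\Omega_\infty^{p(\cdot)}=\{x\in X:p(x)=\infty\}$ and $$\rho_{p(\cdot)}(f)=\int_{X\setminus\Omega_\infty^{p(\cdot)}}|f(x)|^{p(x)}\,d\mu(x)+\|f\|_{L^\infty(\Omega_\infty^{p(\cdot)})}.$$ $L^{p(\cdot)}(X)$ is the set of measurable $f$ with $\rho_{p(\cdot)}(f/\lambda)<\infty$ for some $\lambda>0$, with norm $\|f\|_{p(\cdot)}=\inf\{\lambda>0:\rho_{p(\cdot)}(f/\lambda)\le1\}$. Put $p_-=\operatorname{ess\,inf}_{x\in X}p(x)$ and $p_+=\operatorname{ess\,sup}_{x\in X}p(x)$. Log-Hölder conditions: for $r(\cdot):X\to[0,\infty)$, $r(\cdot)\in LH_0$ if there is $C_0$ with $|r(x)-r(y)|\le \frac{-C_0}{\log d(x,y)}$ for all $x\neq y$ in $X$ with $d(x,y)<1/2$. $r(\cdot)\in LH_\infty$ (with respect to a base point $x_0\in X$; the choice of base point is immaterial up to changing the constant) if there are constants $C_\infty,r_\infty$ with $|r(x)-r_\infty|\le\frac{C_\infty}{\log(e+d(x,x_0))}$ for all $x\in X$. $LH=LH_0\cap LH_\infty$. *)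

(* Defs.v *)
From HB Require Import structures.
From mathcomp Require Export all_boot all_order all_algebra.
From mathcomp Require Export all_classical all_reals all_analysis.
From mathcomp Require Export measurable_realfun ess_sup_inf.

Set Implicit Arguments.
Unset Strict Implicit.
Unset Printing Implicit Defensive.

Import Order.TTheory GRing.Theory Num.Theory.
Import numFieldNormedType.Exports.

Local Open Scope classical_set_scope.
Local Open Scope ring_scope.

Record quasi_metric (R : realType) (X : Type) (dist : X -> X -> R) : Prop :=
  QuasiMetric {
    qm_ge0 : forall x y, 0 <= dist x y ;
    qm_eq0 : forall x y, dist x y = 0 <-> x = y ;
    qm_sym : forall x y, dist x y = dist y x ;
    qm_tri : exists2 A0 : R, 1 <= A0 &
      forall x y z, dist x y <= A0 * (dist x z + dist y z) }.

Definition qball (R : realType) (X : Type) (dist : X -> X -> R)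
    (x : X) (r : R) : set X :=
  [set y | dist x y < r].

Definition qopen (R : realType) (X : Type) (dist : X -> X -> R) (U : set X) :
    Prop :=
  forall x, U x -> exists2 r : R, 0 < r & qball dist x r `<=` U.

(* Balls of a quasi-metric space need not be open, so both families are needed. *)
Definition ball_or_open (R : realType) (X : Type) (dist : X -> X -> R) :
    set (set X) :=
  [set A | (exists x, exists2 r : R, 0 < r & A = qball dist x r)
           \/ qopen dist A].

Record homogeneous_space (R : realType) (disp : measure_display)
    (X : measurableType disp) (dist : X -> X -> R)
    (mu : {measure set X -> \bar R}) : Prop := HomogeneousSpace {
  hs_quasi_metric : quasi_metric dist ;
  hs_sigma_algebra :
    (@measurable disp X : set (set X)) = <<s ball_or_open dist >> ;
  hs_ball_gt0 : forall x (r : R), 0 < r -> (0 < mu (qball dist x r))%E ;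
  hs_ball_lty : forall x (r : R), 0 < r -> (mu (qball dist x r) < +oo)%E ;
  hs_doubling : exists2 Cmu : R, 1 <= Cmu & forall x (r : R), 0 < r ->
    (mu (qball dist x (2 * r)) <= Cmu%:E * mu (qball dist x r))%E }.

Record reverse_doubling_space (R : realType) (disp : measure_display)
    (X : measurableType disp) (dist : X -> X -> R)
    (mu : {measure set X -> \bar R}) : Prop := ReverseDoublingSpace {
  rds_homogeneous : homogeneous_space dist mu ;
  rds_reverse_doubling : exists gamma : R, [/\ 0 < gamma, gamma < 1 &
    forall x (r : R), 0 < r -> qball dist x r `<` [set: X] ->
      (mu (qball dist x (r / 2)) <= gamma%:E * mu (qball dist x r))%E] }.

(* Balls have finite measure, so [fine] loses nothing. For y = x the ball is
   empty and the kernel, formally 1/0, is 0 here: the diagonal is excluded from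
   the integral. In a reverse doubling space with at least two points the
   diagonal section {x} is null anyway. When the positive and the negative parts
   of the integrand both have infinite integral, the value is -oo, so that
   |I_eta f x| = +oo whenever the integral is not absolutely convergent. *)
Definition frac_integral (R : realType) (disp : measure_display)
    (X : measurableType disp) (dist : X -> X -> R)
    (mu : {measure set X -> \bar R}) (eta : R) (f : X -> \bar R) (x : X) :
    \bar R :=
  (\int[mu]_y
     (f y * ((fine (mu (qball dist x (dist x y))) `^ (1 - eta))^-1)%:E))%E.

Section VariableLebesgue.
Context (R : realType) (disp : measure_display) (X : measurableType disp).
Implicit Types (mu : {measure set X -> \bar R}) (p f : X -> \bar R).

Definition Omega_infty p : set X := [set x | p x = +oo%E].

Definition modular mu p f : \bar R :=
  (\int[mu]_(x in ~` Omega_infty p) (`|f x| `^ fine (p x))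
   + 'N[mu]_+oo[f \_ (Omega_infty p)])%E.

Definition scale_inv f (l : R) : X -> \bar R := fun x => (f x * (l^-1)%:E)%E.

Definition vLebesgue mu p : set (X -> \bar R) :=
  [set f : X -> \bar R | measurable_fun setT f /\
    exists2 l : R, 0 < l & (modular mu p (scale_inv f l) < +oo)%E].

Definition vnorm mu p f : \bar R :=
  ereal_inf [set l%:E | l in
    [set l : R | 0 < l /\ (modular mu p (scale_inv f l) <= 1)%E]].

End VariableLebesgue.

Definition LH0 (R : realType) (X : Type) (dist : X -> X -> R) (r : X -> R) :
    Prop :=
  exists C0 : R, forall x y, x <> y -> dist x y < 1 / 2 ->
    `|r x - r y| <= - C0 / ln (dist x y).

Definition LH_infty (R : realType) (X : Type) (dist : X -> X -> R) (x0 : X)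
    (r : X -> R) : Prop :=
  exists Cinf rinf : R, forall x,
    `|r x - rinf| <= Cinf / ln (expR 1 + dist x x0).

Definition LH (R : realType) (X : Type) (dist : X -> X -> R) (x0 : X)
    (r : X -> R) : Prop :=
  LH0 dist r /\ LH_infty dist x0 r.

(* Main.v *)
Require Import Defs.
From mathcomp Require Import ring lra zify.
Import Order.TTheory GRing.Theory Num.Theory.
Import numFieldNormedType.Exports.
Local Open Scope classical_set_scope.
Local Open Scope ring_scope.
Set Implicit Arguments.
Unset Strict Implicit.
Unset Printing Implicit Defensive.

(* Let m(x, r) be the measure of B(x, r), and split f >= 0 of modular at most 1
   into a large part f > 1 and a small part f <= 1.

   Hedberg: if the averages of h over the balls B centered at x are bounded both
   by w^(1/P) and by mu(B)^(-1/P), up to a constant, then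
   I_eta h(x) <= C w^(1/P - eta), by summing over dyadic annuli.

   Large part: on B = B(x, r) the log-Hoelder conditions give
   |p(x) - p(y)| log(1/m(x, r)) <= L, so the average of f over B is comparable to
   a power s/p(x) of that of G = f^(p/s), where s = p_-. The L^s maximal theorem
   applied to G yields w, and Hedberg with P = p(x) gives
   (I_eta f)^q <= C w with w integrable.

   Small part: since f <= 1, f^(p_oo) <= C f^p + omega^(-M), where
   omega = e + d(., x0) and omega^(-M) is integrable. Thus f is in L^(p_oo), and
   Hedberg with P = p_oo and the L^(p_oo) maximal theorem bound I_eta f by a
   function which is at most 1 (up to a constant) and in L^(q_oo); it is
   therefore in L^q by the same exchange of exponents.

   If mu(X) is finite, then X is bounded by the reverse doubling condition, so
   1/p in LH_0 already implies p in LH. *)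

(** * Integrals of nonnegative functions *)

(** Two obstacles shape the proof. It is replaced by an affine bound with a free level [t]
    ([powR_chord]), which integrates termwise even if the exponent depends on the point. The error
    made by exchanging [p y] for [p x] is a power of [t] with exponent of order [p x - p y]; it is
    controlled when [t] is at least 1 and at most a multiple of the reciprocal of the measure of the
    ball. Averages below 1 are easy when [f] takes no value in (0, 1], but not otherwise: hence the
    splitting, and the comparison of the small part with a constant exponent. The second obstacle is
    that maximal functions may be infinite and raise measurability questions. Every pointwise
    estimate is therefore stated with a measurable majorant [W] of finite integral and a real
    [w >= W x]; it says nothing where [W x] is infinite. *)

Section integral_bounds.
Context (R : realType) (d : measure_display) (T : measurableType d).
Variable mu : {measure set T -> \bar R}.
Local Open Scope ereal_scope.

(* Unlike [ge0_le_integral], no measurability: the integral of a nonnegative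
   function is a supremum over simple functions. *)
Lemma ge0_le_integralT (f g : T -> \bar R) : (forall x, 0 <= f x) ->
  (forall x, f x <= g x) -> \int[mu]_x f x <= \int[mu]_x g x.
Proof.
move=> f0 fg; have g0 x : 0 <= g x by exact: le_trans (fg x).
rewrite !ge0_integralTE//; apply: le_ereal_sup => _ [h hf <-].
by exists h => // x; exact: le_trans (fg x).
Qed.

(** Summing over all [n] replaces a measurable choice of the [n] that works at each point; the price
    is only the sum of a geometric series. *)
Lemma ge0_integral_geometric_le (f : T -> \bar R) (F : nat -> T -> \bar R)
    (c z : R) :
  (forall x, 0 <= f x) -> (forall n x, 0 <= F n x) ->
  (forall n, measurable_fun setT (F n)) ->
  (forall x, exists n, f x <= F n x) ->
  (0 <= c)%R -> (0 < z < 1)%R ->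
  (forall n, \int[mu]_x F n x <= (c * z ^+ n)%:E) ->
  \int[mu]_x f x <= (c / (1 - z))%:E.
Proof.
move=> f0 F0 mF fF c0 /andP[z0 z1] intF.
apply: (@le_trans _ _ (\int[mu]_x \sum_(n <oo) F n x)).
  apply: ge0_le_integralT => // x; have [n fFn] := fF x.
  apply: (le_trans fFn); apply: le_trans (@nneseries_lim_ge _ _ xpredT 0 n.+1 _).
    by rewrite big_mkord big_ord_recr/= leeDr// sume_ge0.
  by move=> k _ _; exact: F0.
rewrite integral_nneseries//.
apply: lime_le.
  by apply: is_cvg_nneseries => n _ _; apply: integral_ge0 => x _; exact: F0.
apply: nearW => n; apply: (@le_trans _ _ (\sum_(0 <= i < n) (c * z ^+ i)%:E)).
  by apply: lee_sum => i _; exact: intF.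
rewrite sumEFin lee_fin.
have := @geometric_le_lim R n c z c0 z0; rewrite gtr0_norm//; exact.
Qed.

Lemma measurable_lt_set (f g : T -> R) : measurable_fun setT f ->
  measurable_fun setT g -> measurable [set x | (f x < g x)%R].
Proof.
move=> mf mg; rewrite -[X in measurable X]setTI.
rewrite (_ : [set x | _] = (fun x => (f x < g x)%R) @^-1` [set true])//.
exact: (measurable_fun_ltr mf mg).
Qed.

Lemma ge0_integralZ_EFin (D : set T) (k : R) (h : T -> R) : measurable D ->
  (0 <= k)%R -> measurable_fun D h -> (forall x, (0 <= h x)%R) ->
  \int[mu]_(x in D) (k * h x)%:E = k%:E * \int[mu]_(x in D) (h x)%:E.
Proof.
move=> mD k0 mh h0; rewrite -ge0_integralZl_EFin//.
- by move=> x _; rewrite lee_fin.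
- exact/measurable_EFinP.
Qed.

Lemma ge0_integralD_EFin (D : set T) (h k : T -> R) : measurable D ->
  measurable_fun D h -> measurable_fun D k -> (forall x, (0 <= h x)%R) ->
  (forall x, (0 <= k x)%R) ->
  \int[mu]_(x in D) (h x + k x)%:E =
  \int[mu]_(x in D) (h x)%:E + \int[mu]_(x in D) (k x)%:E.
Proof.
move=> mD mh mk h0 k0; rewrite -ge0_integralD//.
- by move=> x _; rewrite lee_fin.
- exact/measurable_EFinP.
- by move=> x _; rewrite lee_fin.
- exact/measurable_EFinP.
Qed.

Lemma ge0_le_integral_EFin (D : set T) (h k : T -> R) : measurable D ->
  measurable_fun D h -> measurable_fun D k -> (forall x, (0 <= h x)%R) ->
  (forall x, D x -> (h x <= k x)%R) ->
  \int[mu]_(x in D) (h x)%:E <= \int[mu]_(x in D) (k x)%:E.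
Proof.
move=> mD mh mk h0 hk; apply: ge0_le_integral => //.
- by move=> x _; rewrite lee_fin.
- exact/measurable_EFinP.
- exact/measurable_EFinP.
Qed.

Lemma ge0_integralM_indic_le (E D : set T) (h : T -> R) : E `<=` D ->
  (forall x, (0 <= h x)%R) ->
  \int[mu]_x (h x * \1_E x)%:E <= \int[mu]_(x in D) (h x)%:E.
Proof.
move=> ED h0; rewrite [leRHS]integral_mkcond; apply: ge0_le_integralT => x.
  by rewrite lee_fin mulr_ge0.
rewrite patchE indicE; have [/set_mem/ED xD|_] := boolP (x \in E).
  by rewrite mem_set// mulr1.
by rewrite mulr0; case: ifP => // _; rewrite lee_fin.
Qed.

End integral_bounds.

(** * Balls in spaces of homogeneous type *)

Definition ball_measure (R : realType) (disp : measure_display)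
    (X : measurableType disp) (dist : X -> X -> R)
    (mu : {measure set X -> \bar R}) (x : X) (r : R) : R :=
  fine (mu (qball dist x r)).

Lemma ex_exp2_ge (R : realType) (c : R) : exists n, c <= 2 ^+ n.
Proof.
have [n cn] : exists n : nat, c <= n%:R.
  exists (Num.truncn `|c|).+1.
  by apply: (le_trans (ler_norm _)); exact/ltW/truncnS_gt.
exists n; apply: (le_trans cn).
by rewrite -natrX ler_nat; apply: ltnW; exact: ltn_expl.
Qed.

Section balls.
Context (R : realType) (disp : measure_display) (X : measurableType disp).
Context (dist : X -> X -> R) (mu : {measure set X -> \bar R}).
Context (hX : homogeneous_space dist mu).
Local Notation B := (qball dist).
Local Notation m := (ball_measure dist mu).

Lemma dist_ge0 x y : 0 <= dist x y.
Proof. by case: (hs_quasi_metric hX). Qed.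

Lemma dist_refl x : dist x x = 0.
Proof. exact/(qm_eq0 (hs_quasi_metric hX)). Qed.

Lemma dist_gt0 x y : x <> y -> 0 < dist x y.
Proof.
move=> xy; rewrite lt_neqAle dist_ge0 andbT eq_sym; apply/eqP => d0; apply: xy.
exact/(qm_eq0 (hs_quasi_metric hX)).
Qed.

Lemma dist_sym x y : dist x y = dist y x.
Proof. by case: (hs_quasi_metric hX). Qed.

Lemma qball_center x r : 0 < r -> B x r x.
Proof. by rewrite /qball/= dist_refl. Qed.

Lemma qball_le0 x r : r <= 0 -> B x r = set0.
Proof.
move=> r0; rewrite -subset0 => y /=; apply/negP; rewrite -leNgt.
exact: le_trans (dist_ge0 _ _).
Qed.

Lemma measurable_qball x r : measurable (B x r).
Proof.
have [r0|r0] := ltP 0 r; last by rewrite qball_le0.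
rewrite (hs_sigma_algebra hX); apply: sub_sigma_algebra.
by left; exists x; exists r.
Qed.
Hint Resolve measurable_qball : core.

Lemma ball_measureE x r : mu (B x r) = (m x r)%:E.
Proof.
have [r0|r0] := ltP 0 r; last by rewrite /m qball_le0// measure0.
by rewrite fineK// fin_numElt (lt_trans _ (hs_ball_gt0 hX x r0))// hs_ball_lty.
Qed.

Lemma ball_measure_gt0 x r : 0 < r -> 0 < m x r.
Proof. by move=> r0; rewrite -lte_fin -ball_measureE (hs_ball_gt0 hX). Qed.

Lemma ball_measure_ge0 x r : 0 <= m x r.
Proof. by rewrite -lee_fin -ball_measureE. Qed.

Lemma ball_measure_sub x r y s : B x r `<=` B y s -> m x r <= m y s.
Proof. by move=> xy; rewrite -lee_fin -!ball_measureE le_measure// inE. Qed.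

Lemma ball_measure_le x r s : r <= s -> m x r <= m x s.
Proof. by move=> rs; apply: ball_measure_sub => y /= /lt_le_trans; exact. Qed.

Lemma ball_measure_scale (c : R) : exists2 K : R, 1 <= K &
  forall x r, 0 < r -> m x (c * r) <= K * m x r.
Proof.
have [Cmu Cmu1 dbl] := hs_doubling hX; have [n cn] := ex_exp2_ge c.
exists (Cmu ^+ n); first exact: exprn_ege1.
move=> x r r0; apply: (@le_trans _ _ (m x (2 ^+ n * r))).
  by apply: ball_measure_le; rewrite ler_pM2r.
elim: n {cn} => [|n IH]; first by rewrite !mul1r.
rewrite !exprS -!mulrA; apply: (@le_trans _ _ (Cmu * m x (2 ^+ n * r))).
  by rewrite -lee_fin EFinM -!ball_measureE dbl// mulr_gt0// exprn_gt0.
by rewrite ler_pM2l// (lt_le_trans _ Cmu1).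
Qed.

Lemma measurable_dist x : measurable_fun setT (dist x).
Proof.
apply: (measurability (@RGenInftyO.G R)); first exact: RGenInftyO.measurableE.
move=> _ [_ [r ->]] <-; rewrite setTI.
rewrite (_ : _ @^-1` _ = B x r); first exact: measurable_qball.
by apply/seteqP; split => y /=; rewrite in_itv.
Qed.

Lemma measurable_ball_measure_dist x :
  measurable_fun setT (fun y => m x (dist x y)).
Proof.
apply: (measurableT_comp _ (measurable_dist x)).
apply: nondecreasing_measurable => //.
by move=> r s; exact: ball_measure_le.
Qed.

End balls.

(** * Countable families of balls *)

(** The integer powers of 2, indexed by a sign and a natural number so that each half gives an
    ordinary series over [nat]. The value 1 occurs in both halves, which is harmless for upper
    bounds. *)
Definition dyad (R : realType) (b : bool) (n : nat) : R :=
  if b then 2 ^+ n else (2 ^+ n)^-1.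

Lemma dyad_gt0 (R : realType) b n : 0 < dyad R b n.
Proof. by case: b; rewrite /dyad ?invr_gt0 exprn_gt0. Qed.

Lemma ex_exp2_between (R : realType) (c : R) : 1 < c ->
  exists n, 2 ^+ n < c <= 2 ^+ n.+1.
Proof.
move=> c1; have [n cn] := ex_exp2_ge c.
elim: n cn => [|n IH] cn; first by rewrite expr0 leNgt c1 in cn.
have [/IH//|nc] := leP c (2 ^+ n).
by exists n; rewrite nc.
Qed.

Lemma ex_dyad (R : realType) (a : R) : 0 < a ->
  exists b n, dyad R b n < a <= 2 * dyad R b n.
Proof.
move=> a0.
have [a1|a1] := leP a 1; last first.
  by have [n ?] := ex_exp2_between a1; exists true, n; rewrite /dyad -exprS.
have [n] := ex_exp2_ge (2 / a).
rewrite ler_pdivrMr// mulrC => an.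
have {an} : 1 < a * 2 ^+ n by lra.
elim: n => [|n IH]; first by rewrite expr0 mulr1 ltNge a1.
have [/IH//|an an1] := ltP 1 (a * 2 ^+ n).
have n0 : (0 : R) < 2 ^+ n by rewrite exprn_gt0.
exists false, n.+1; rewrite /dyad exprS invfM mulrA divff// mul1r -invfM -exprS.
apply/andP; split; first by rewrite -[ltLHS]mul1r ltr_pdivrMr ?exprn_gt0.
by rewrite -[leRHS]mul1r ler_pdivlMr.
Qed.

Section covering.
Context (R : realType) (disp : measure_display) (X : measurableType disp).
Context (dist : X -> X -> R) (mu : {measure set X -> \bar R}).
Context (hX : homogeneous_space dist mu).
Local Notation B := (qball dist).
Local Notation m := (ball_measure dist mu).

(** Packing argument: the balls centered in [B x0 k] lie in one ball of measure [M], while doubling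
    gives each of them measure at least [M / K], so at most [K] of them are disjoint. Hence [E] is a
    countable union of finite sets. *)
Lemma trivIset_qball_countable (r : R) (E : set X) : 0 < r ->
  trivIset E (fun x => B x r) -> countable E.
Proof.
move=> r0 tE; have [->|/set0P[x0 _]] := eqVneq E set0; first exact: countable0.
have -> : E = \bigcup_k (E `&` B x0 k%:R).
  apply/seteqP; split => [x Ex|x [k _ []//]].
  exists (Num.truncn (dist x0 x)).+1 => //; split => //=.
  exact: truncnS_gt.
apply: bigcup_countable => // k _; apply: finite_set_countable.
have [A0 A01 tri] := qm_tri (hs_quasi_metric hX).
have A00 : 0 < A0 by exact: lt_le_trans A01.
set rho := A0 * (k%:R + r).
have rho0 : 0 < rho by rewrite mulr_gt0// ltr_wpDl.
have [K K1 scaleK] := ball_measure_scale hX (A0 * (k%:R + rho) / r).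
have K0 : 0 < K by exact: lt_le_trans K1.
set M := m x0 rho.
have M0 : 0 < M by exact: ball_measure_gt0.
have ballM x : B x0 k%:R x -> M / K <= m x r.
  move=> /= xk; rewrite ler_pdivrMr// mulrC; apply: le_trans (scaleK _ _ r0).
  apply: ball_measure_sub => // y /= yrho; rewrite divfK ?gt_eqF//.
  apply: (le_lt_trans (tri _ _ x0)); rewrite ltr_pM2l//.
  by rewrite ltrD// (dist_sym hX).
apply: contrapT => infE.
have [n nK] : exists n, K < n%:R :> R.
  by exists (Num.truncn K).+1; exact: truncnS_gt.
have [F FE Fn] := infinite_set_fset n infE.
have : (mu (\big[setU/set0]_(i <- finmap.enum_fset F) B i r) <= mu (B x0 rho))%E.
  rewrite le_measure// ?inE.
  - by apply: bigsetU_measurable => i _; exact: (measurable_qball hX).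
  - exact: (measurable_qball hX).
  - rewrite -bigcup_fset => z [i /FE[_ /= ik] /= iz].
    apply: (le_lt_trans (tri _ _ i)); rewrite ltr_pM2l// ltrD//.
    by rewrite (dist_sym hX).
rewrite measure_fbigsetU//=.
- rewrite (ball_measureE hX) => sumM.
  have : (\sum_(i <- finmap.enum_fset F) (M / K)%:E <= M%:E)%E.
    apply: le_trans sumM; rewrite !big_seq; apply: lee_sum => i iF.
    by rewrite (ball_measureE hX) lee_fin; apply: ballM; exact: (FE _ iF).2.
  rewrite sumEFin lee_fin big_const_seq count_predT iter_addr addr0.
  apply/negP; rewrite -ltNge -mulr_natr.
  rewrite mulrAC ltr_pdivlMr// ltr_pM2l//; apply: (lt_le_trans nK).
  by rewrite ler_nat.
- by move=> i _; exact: (measurable_qball hX).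
- by apply: sub_trivIset tE => i /FE[].
Qed.

(* A countable family of balls that can replace every ball up to a constant:
   at each dyadic scale, the centers of a maximal disjoint family of balls. *)
Lemma countable_ball_family : exists (c : nat -> X) (r : nat -> R),
  (forall n, 0 < r n) /\
  exists2 K : R, 1 <= K & forall x rho, 0 < rho ->
    exists n, B x rho `<=` B (c n) (r n) /\ m (c n) (r n) <= K * m x rho.
Proof.
have [A0 A01 tri] := qm_tri (hs_quasi_metric hX).
have A00 : 0 < A0 by exact: lt_le_trans A01.
pose rad (i : bool * nat) : R := 2 * dyad R i.1 i.2.
have rad0 i : 0 < rad i by rewrite mulr_gt0// dyad_gt0.
pose E i := projT1 (ex_maximal_disjoint_subcollection
  (fun x => B x (rad i)) [set: X]).
have maxE i : maximal_disjoint_subcollection (fun x => B x (rad i)) (E i) setT.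
  exact: (projT2 (ex_maximal_disjoint_subcollection _ _)).
pose S := \bigcup_i [set (x, i) | x in E i].
have cS : countable S.
  apply: bigcup_countable => [|i _]; first exact: countableP.
  apply: card_le_trans (card_image_le _ _) _.
  by have [_ tE _] := maxE i; exact: trivIset_qball_countable tE.
have [K K1 scaleK] := ball_measure_scale hX
  (A0 * (A0 * (2 * A0 + 1) + 2 * A0) * 2).
have near_net x rho : 0 < rho -> exists2 s, S s &
    B x rho `<=` B s.1 (A0 * (2 * A0 + 1) * rad s.2) /\
    m s.1 (A0 * (2 * A0 + 1) * rad s.2) <= K * m x rho.
  move=> rho0; have [b [n /andP[rho1 rho2]]] := ex_dyad rho0.
  pose i := (b, n).
  have [y Ey [z [/= yz xz]]] : exists2 y, E i y &
      exists z, B y (rad i) z /\ B x (rad i) z.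
    (* Otherwise [x] could be added to the net at this scale, against its maximality. *)
    apply: contrapT => noy; have [_ tE maxEi] := maxE i.
    have notE u : E i u -> B u (rad i) `&` B x (rad i) !=set0 -> False.
      by move=> Eu [v uv]; apply: noy; exists u => //; exists v.
    apply: (maxEi (E i `|` [set x])) => //.
      split; first exact: subsetUl.
      move=> /(_ x (or_intror erefl)) /notE; apply.
      by exists x; split; exact: (qball_center hX).
    move=> u v [Eu|->] [Ev|->] //; first exact: tE.
    - by move=> /(notE _ Eu).
    - by rewrite setIC => /(notE _ Ev).
  have ratio : rad i < 2 * rho by rewrite ltr_pM2l.
  have xy : dist x y < A0 * (2 * rad i).
    apply: (le_lt_trans (tri _ _ z)); rewrite ltr_pM2l// mulr_natl mulr2n.
    exact: ltrD.
  (* The dilation [A0 * (2 * A0 + 1)] comes from two uses of the quasi-triangle inequality: from [y]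
     to [x] through [z], then from [x] to a point of [B x rho], where [rho <= rad i]. *)
  exists (y, i); first by exists i => //; exists y.
  split=> [u /= xu|/=].
    apply: (le_lt_trans (tri _ _ x)); rewrite -mulrA ltr_pM2l// mulrDl mul1r.
    rewrite ltrD//; first by rewrite (dist_sym hX) -mulrA mulrCA.
    by rewrite (dist_sym hX) (lt_le_trans xu).
  apply: le_trans (scaleK _ _ rho0); apply: ball_measure_sub => // u /= yu.
  apply: (le_lt_trans (tri _ _ y)).
  rewrite -!mulrA ltr_pM2l//.
  apply: (@lt_le_trans _ _ ((A0 * (2 * A0 + 1) + 2 * A0) * rad i)).
    rewrite mulrDl addrC ltrD//; first by rewrite (dist_sym hX).
    by rewrite (lt_le_trans xy)// mulrCA mulrA.
  rewrite ler_pM2l; first exact: ltW.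
  by rewrite addr_gt0 ?mulr_gt0// addr_gt0 ?mulr_gt0.
have [S0|[s]] := pfcard_geP cS.
  exists (fun=> point), (fun=> 1); split => //; exists K => // x rho rho0.
  by have [s] := near_net x _ rho0; rewrite S0.
exists (fun n => (s n).1), (fun n => A0 * (2 * A0 + 1) * rad (s n).2).
split=> [n|].
  by apply: mulr_gt0 => //; apply: mulr_gt0 => //; rewrite addr_gt0// mulr_gt0.
exists K => // x rho rho0; have [t St tx] := near_net x _ rho0.
by have [n _ sn] := @surj _ _ _ _ s _ St; exists n; rewrite sn.
Qed.
End covering.

(** * The maximal theorem *)

Lemma seq_argmax (R : realType) (I : eqType) (s : seq I) (r : I -> R) :
  s != [::] -> exists2 i, i \in s & forall j, j \in s -> r j <= r i.
Proof.
elim: s => // i s IH _; have [->|/IH[k ks kmax]] := eqVneq s [::].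
  by exists i; rewrite ?mem_head// => j; rewrite inE => /eqP ->.
have [ik|ki] := leP (r i) (r k).
  exists k; first by rewrite inE ks orbT.
  by move=> j; rewrite inE => /predU1P[->//|/kmax].
exists i; first exact: mem_head.
move=> j; rewrite inE => /predU1P[->//|/kmax rjk].
exact: le_trans (ltW ki).
Qed.

Section weak_type.
Context (R : realType) (disp : measure_display) (X : measurableType disp).
Context (dist : X -> X -> R) (mu : {measure set X -> \bar R}).
Context (hX : homogeneous_space dist mu).
Local Notation B := (qball dist).
Local Notation m := (ball_measure dist mu).

Let mB x r : measurable (B x r). Proof. exact: (measurable_qball hX). Qed.
Hint Resolve mB : core.

(* Vitali covering by induction: a ball of maximal radius absorbs, after
   dilation, all the balls that meet it, and the others are disjoint from it. *)
Lemma weak_type_finite : exists2 K : R, 1 <= K &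
  forall (c : nat -> X) (r : nat -> R) (t : R) (F : X -> \bar R) (s : seq nat),
    (forall n, 0 < r n) -> 0 <= t -> measurable_fun setT F ->
    (forall x, 0 <= F x)%E ->
    (forall i, i \in s ->
      ((t * m (c i) (r i))%:E <= \int[mu]_(x in B (c i) (r i)) F x)%E) ->
    (t%:E * mu (\bigcup_(i in [set` s]) B (c i) (r i)) <=
     K%:E * \int[mu]_(x in \bigcup_(i in [set` s]) B (c i) (r i)) F x)%E.
Proof.
have [A0 A01 tri] := qm_tri (hs_quasi_metric hX).
have A00 : 0 < A0 by exact: lt_le_trans A01.
have [K K1 scaleK] := ball_measure_scale hX (A0 * (2 * A0 + 1)).
have K0 : 0 < K by exact: lt_le_trans K1.
exists K => // c r t F + r0 t0 mF F0.
have mU (s : seq nat) : measurable (\bigcup_(i in [set` s]) B (c i) (r i)).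
  by apply: bigcup_measurable => *.
have mFD D : measurable_fun D F by exact: (measurable_funS _ _ mF).
move=> s; have [n] := ubnP (size s); elim: n s => // n IH s sn tm.
have [->|s0] := eqVneq s [::].
  by rewrite set_nil bigcup_set0 measure0 integral_set0 !mule0.
have [i si imax] := seq_argmax r s0.
pose s' := [seq j <- s | `[< B (c i) (r i) `&` B (c j) (r j) = set0 >]].
have s's : {subset s' <= s} by move=> j; rewrite mem_filter => /andP[].
have is' : i \notin s'.
  rewrite mem_filter negb_and; apply/orP; left; apply/asboolPn => BiBi.
  have : (B (c i) (r i) `&` B (c i) (r i)) (c i).
    by split; exact: (qball_center hX).
  by rewrite BiBi.
have s'n : (size s' < n)%N.
  rewrite -ltnS (leq_trans _ sn)// ltnS size_filter ltn_neqAle count_size andbT.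
  by rewrite -all_count; apply/negP => /allP/(_ _ si) h; rewrite mem_filter h si in is'.
pose U (s : seq nat) := \bigcup_(i in [set` s]) B (c i) (r i).
have {}IH : (t%:E * mu (U s') <= K%:E * \int[mu]_(x in U s') F x)%E.
  by apply: IH => // j /s's; exact: tm.
have dilate j : j \in s -> B (c i) (r i) `&` B (c j) (r j) !=set0 ->
    B (c j) (r j) `<=` B (c i) (A0 * (2 * A0 + 1) * r i).
  move=> js [z [/= iz jz]] u /= ju; apply: (le_lt_trans (tri _ _ (c j))).
  rewrite -mulrA ltr_pM2l// mulrDl mul1r ltr_leD//; last first.
    by rewrite (dist_sym hX) (le_trans (ltW ju))// imax.
  apply: (le_lt_trans (tri _ _ z)); rewrite -mulrA mulrCA ltr_pM2l//.
  by rewrite mulr_natl mulr2n ltr_leD// (le_trans (ltW jz))// imax.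
have UU : U s `<=` B (c i) (A0 * (2 * A0 + 1) * r i) `|` U s'.
  move=> z [j /= js jz].
  have [ij0|/set0P/(dilate _ js)] := eqVneq (B (c i) (r i) `&` B (c j) (r j)) set0.
    by right; exists j => //=; rewrite mem_filter js andbT; apply/asboolP.
  by move=> /(_ _ jz); left.
have dilateK : (mu (B (c i) (A0 * (2 * A0 + 1) * r i)) <=
    K%:E * mu (B (c i) (r i)))%E.
  by rewrite !(ball_measureE hX) -EFinM lee_fin scaleK.
apply: (@le_trans _ _ (t%:E * (K%:E * mu (B (c i) (r i)) + mu (U s'))))%E.
  rewrite lee_wpmul2l ?lee_fin//.
  apply: (le_trans (le_measure mu _ _ UU)); rewrite ?inE.
  - exact: mU.
  - by apply: measurableU => //; exact: mU.
  apply: (le_trans (measureU2 _ _ _)) => //; first exact: mU.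
  rewrite leeD2r//; exact: dilateK.
rewrite ge0_muleDr ?mule_ge0 ?lee_fin//; last exact: ltW.
apply: (@le_trans _ _ (K%:E * \int[mu]_(x in B (c i) (r i)) F x +
  K%:E * \int[mu]_(x in U s') F x))%E.
  apply: leeD => //; rewrite muleCA lee_wpmul2l ?lee_fin ?(ltW K0)//.
  by rewrite (ball_measureE hX) -EFinM tm.
have intF0 D : (0 <= \int[mu]_(x in D) F x)%E by exact: integral_ge0.
rewrite -ge0_muleDr// lee_wpmul2l ?lee_fin ?(ltW K0)//.
(* [s'] keeps only the balls disjoint from ball [i], so the two integrals add up without any overlap
   constant. *)
rewrite -ge0_integral_setU//; last 2 first.
- exact: mU.
- apply/disj_setPS => z [iz [j /=]]; rewrite mem_filter => /andP[/asboolP ij _ jz].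
  by rewrite -[False]/(set0 z) -ij.
apply: ge0_subset_integral => //.
- by apply: measurableU => //; exact: mU.
- by move=> z [iz|[j /= /s's js jz]]; [exists i|exists j].
Qed.

Lemma measurable_trunc (G : X -> R) (t : R) : measurable_fun setT G ->
  measurable_fun setT (fun x => G x * (t < 2 * G x)%R%:R).
Proof.
move=> mG; rewrite (_ : (fun _ => _) = G \* \1_[set x | t < 2 * G x]).
  apply: measurable_funM => //; apply: measurable_indic.
  by apply: measurable_lt_set => //; exact: measurable_funM.
apply/funext => x /=; rewrite indicE; congr (_ * (nat_of_bool _)%:R).
by apply/idP/idP => h; [apply/mem_set|exact: set_mem h].
Qed.

(** On a ball where the average of [G] exceeds [t], the points with [2 * G <= t] account for at most
    [t / 2], so the truncated function still has average at least [t / 2]. Keeping the truncation on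
    the right is what makes the later sum over levels converge. Finite subfamilies exhaust the
    countable one, with a bound uniform in [N]. *)
Lemma weak_type_trunc : exists2 K : R, 1 <= K &
  forall (c : nat -> X) (r : nat -> R) (t : R) (G : X -> R),
    (forall n, 0 < r n) -> 0 < t -> measurable_fun setT G ->
    (forall x, 0 <= G x) ->
    (t%:E * mu (\bigcup_(i in
       [set i | ((t * m (c i) (r i))%:E < \int[mu]_(x in B (c i) (r i)) (G x)%:E)%E])
       B (c i) (r i)) <=
     K%:E * \int[mu]_x (G x * (t < 2 * G x)%R%:R)%:E)%E.
Proof.
have [K K1 weak] := weak_type_finite.
have K0 : 0 < K by exact: lt_le_trans K1.
exists (2 * K) => [|c r t G r0 t0 mG G0]; first by lra.
set P := [set i | _]; pose F x := (G x * (t < 2 * G x)%R%:R)%:E.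
have F0 x : (0 <= F x)%E by rewrite lee_fin mulr_ge0.
have mF : measurable_fun setT F by exact/measurable_EFinP/measurable_trunc.
have PF i : P i -> ((t / 2 * m (c i) (r i))%:E <= \int[mu]_(x in B (c i) (r i)) F x)%E.
  move=> /ltW Pi.
  have : ((t * m (c i) (r i))%:E <= \int[mu]_(x in B (c i) (r i)) F x +
      (t / 2 * m (c i) (r i))%:E)%E.
    apply: (le_trans Pi); rewrite EFinM -(ball_measureE hX) -integral_cst//.
    rewrite -ge0_integralD//; last 2 first.
    - exact: measurable_funTS.
    - by move=> x _; rewrite lee_fin ltW// divr_gt0.
    apply: ge0_le_integral => //.
    - by move=> x _; rewrite lee_fin.
    - by apply/measurable_EFinP; exact: measurable_funTS.
    - by apply: emeasurable_funD => //; exact: measurable_funTS.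
    move=> x _; rewrite /F /cst -EFinD lee_fin.
    have [h|h] := ltP t (2 * G x); rewrite ?mulr1 ?mulr0 ?add0r; last by lra.
    by rewrite lerDl divr_ge0// ltW.
  rewrite -leeBlDr// -EFinB; congr (_ <= _)%E; congr EFin; lra.
pose Q N := [seq i <- iota 0 N | `[< P i >]].
have QP N i : i \in Q N -> P i by rewrite mem_filter => /andP[/asboolP].
have mQ N : measurable (\bigcup_(i in [set` Q N]) B (c i) (r i)).
  by apply: bigcup_measurable => *.
have bound N : (t%:E * mu (\bigcup_(i in [set` Q N]) B (c i) (r i)) <=
    (2 * K)%:E * \int[mu]_x F x)%E.
  have t20 : 0 <= t / 2 by rewrite divr_ge0// ltW.
  have := weak c r (t / 2) F (Q N) r0 t20 mF F0 (fun i iQ => PF i (QP N i iQ)).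
  move=> h.
  have -> : t = 2 * (t / 2) by lra.
  rewrite !EFinM -!muleA lee_pmul2l// (muleA (t%:E)) -EFinM; apply: (le_trans h).
  by rewrite lee_pmul2l//; apply: ge0_subset_integral.
have UQ : \bigcup_(i in P) B (c i) (r i) =
    \bigcup_N \bigcup_(i in [set` Q N]) B (c i) (r i).
  apply/seteqP; split => [x [i Pi ix]|x [N _ [i /QP Pi ix]]]; last by exists i.
  exists i.+1 => //; exists i => //=; rewrite mem_filter mem_iota/= ltnSn andbT.
  exact/asboolP.
rewrite UQ -lee_pdivlMl//.
have /cvg_lim <- // : mu \o (fun N => \bigcup_(i in [set` Q N]) B (c i) (r i)) @ \oo -->
    mu (\bigcup_N \bigcup_(i in [set` Q N]) B (c i) (r i)).
  apply: nondecreasing_cvg_mu => //; first exact: bigcup_measurable.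
  move=> a b ab; apply/subsetPset => x [i /=]; rewrite mem_filter mem_iota /=.
  move=> /andP[Pi ia] ix; exists i => //=; rewrite mem_filter mem_iota/= Pi.
  exact: leq_trans ia ab.
apply: lime_le; last first.
  by apply: nearW => N; rewrite lee_pdivlMl//; exact: bound.
apply: ereal_nondecreasing_is_cvgn => a b ab /=; apply: le_measure; rewrite ?inE//.
move=> x [i /=]; rewrite mem_filter mem_iota /=.
move=> /andP[Pi ia] ix; exists i => //=; rewrite mem_filter mem_iota/= Pi.
exact: leq_trans ia ab.
Qed.

End weak_type.

(** The retained terms form an increasing geometric sum, dominated by its last term, which is below
    [u]; so the constant depends neither on [a] nor on [N]. *)
Lemma geometric_trunc_le (R : realFieldType) (b a u : R) (N : nat) :
  1 < b -> 0 < a -> 0 <= u ->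
  \sum_(i < N) a * b ^+ i * (a * b ^+ i < u)%R%:R <= u * (b / (b - 1)).
Proof.
move=> b1 a0 u0; have b10 : 0 < b - 1 by lra.
have bb0 : 0 <= b / (b - 1) by rewrite divr_ge0; lra.
elim: N => [|N IH]; first by rewrite big_ord0 mulr_ge0.
rewrite big_ord_recr/=; have [abu|_] := ltP (a * b ^+ N) u; last first.
  by rewrite mulr0 addr0.
rewrite mulr1.
have : \sum_(i < N) a * b ^+ i * (a * b ^+ i < u)%R%:R <= \sum_(i < N) a * b ^+ i.
  apply: ler_sum => i _; apply: ler_piMr; last by rewrite lern1 leq_b1.
  by apply: mulr_ge0; [exact: ltW|apply: exprn_ge0; lra].
rewrite -mulr_sumr.
have -> : \sum_(i < N) b ^+ i = (b ^+ N - 1) / (b - 1).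
  apply: (mulIf (x := b - 1)); first by rewrite gt_eqF.
  by rewrite divfK ?gt_eqF// mulrC subrX1.
have {bb0} : a * b ^+ N * (b / (b - 1)) <= u * (b / (b - 1)).
  by rewrite ler_wpM2r// ltW.
move=> h1 h2; rewrite -lerBrDr; apply: (le_trans h2); rewrite lerBrDr.
apply: le_trans h1; rewrite -subr_ge0.
have -> : a * b ^+ N * (b / (b - 1)) - (a * ((b ^+ N - 1) / (b - 1)) + a * b ^+ N)
  = a / (b - 1).
  by field; rewrite gt_eqF.
by rewrite divr_ge0// ltW.
Qed.

Lemma powR_subr1 (R : realType) (a x : R) : 0 < x -> x `^ (a - 1) * x = x `^ a.
Proof.
move=> x0; have xn : x != 0 by rewrite gt_eqF.
by rewrite powRB ?xn ?implybT// powRr1 ?ltW// divfK.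
Qed.

Lemma dyad_trunc_le (R : realType) (sg : R) : 0 < sg -> exists2 C : R, 0 < C &
  forall b N (u : R), 0 <= u ->
  \sum_(i < N) dyad R b i `^ sg * (dyad R b i < u)%R%:R <= C * u `^ sg.
Proof.
move=> sg0; set B : R := 2 `^ sg.
have B0 : 0 < B by rewrite powR_gt0.
have B1 : 1 < B.
  by rewrite -[ltLHS](congr1 (@^~ sg) (powR1 R)) gt0_ltr_powR// ?nnegrE; lra.
exists (B / (B - 1)); first by rewrite divr_gt0// subr_gt0.
move=> b N u u0; rewrite mulrC.
have powB i : (2 ^+ i : R) `^ sg = B ^+ i.
  by rewrite -powR_mulrn// -powRrM mulrC powRrM powR_mulrn// ltW.
have step (a : R) (g : 'I_N -> 'I_N) : 0 < a -> injective g ->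
    (forall i, dyad R b (g i) `^ sg = a * B ^+ i) ->
    \sum_(i < N) dyad R b i `^ sg * (dyad R b i < u)%R%:R <= u `^ sg * (B / (B - 1)).
  move=> a0 ginj ga; rewrite (reindex_inj ginj)/=.
  apply: le_trans (geometric_trunc_le N B1 a0 (powR_ge0 _ _)).
  apply: ler_sum => i _; rewrite ga ler_wpM2l//.
    by rewrite mulr_ge0 ?exprn_ge0// ltW.
  rewrite -ga; have [h|] := ltP (dyad R b (g i)) u; last by [].
  by rewrite gt0_ltr_powR// nnegrE ltW// dyad_gt0.
case: b step => step.
  apply: (step 1 id) => //.
  by move=> i; rewrite mul1r /dyad powB.
(* The scales [2^-n] decrease, so the sum is read backwards, starting from its smallest term. *)
apply: (step (B ^+ N.-1)^-1 (@rev_ord N)).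
- by rewrite invr_gt0 exprn_gt0.
- exact: rev_ord_inj.
- move=> i; rewrite /dyad -powR_inv1 ?exprn_ge0// -powRrM mulrC powRrM powB.
  rewrite powR_inv1 ?exprn_ge0 ?ltW//=.
  have -> : N.-1 = (N - i.+1 + i)%N by case: i => i /=; lia.
  by rewrite exprD invfM -mulrA mulVf ?mulr1// gt_eqF// exprn_gt0.
Qed.

Section maximal.
Context (R : realType) (disp : measure_display) (X : measurableType disp).
Context (dist : X -> X -> R) (mu : {measure set X -> \bar R}).
Context (hX : homogeneous_space dist mu).
Local Notation B := (qball dist).
Local Notation m := (ball_measure dist mu).

Let mB x r : measurable (B x r). Proof. exact: (measurable_qball hX). Qed.
Hint Resolve mB : core.

(* [W] plays the role of [(M G) ^ s] for a maximal function [M]; phrasing it as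
   a measurable majorant avoids discussing the measurability of [M G]. *)
Lemma maximal_majorant (s : R) : 1 < s -> exists2 C : R, 0 < C &
  forall G : X -> R, measurable_fun setT G -> (forall x, 0 <= G x) ->
  exists W : X -> \bar R, [/\ measurable_fun setT W, (forall x, 0 <= W x)%E,
    (\int[mu]_x W x <= C%:E * \int[mu]_x (G x `^ s)%:E)%E &
    forall x rho w, 0 < rho -> 0 < w -> (W x <= w%:E)%E ->
      (\int[mu]_(y in B x rho) (G y)%:E <= (w `^ s^-1 * m x rho)%:E)%E].
Proof.
move=> s1; have s0 : 0 < s by lra.
have [c [r [r0 [L L1 cover]]]] := countable_ball_family hX.
have [K K1 weak] := weak_type_trunc hX.
have L0 : 0 < L by lra.
have K0 : 0 < K by lra.
have [D D0 geo] := @dyad_trunc_le R (s - 1) ltac:(lra).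
(* [L ^ s] pays for replacing a ball by one of the countable family; the factor 2 makes the final
   comparison with [v] strict. *)
pose c0 := 2 * L `^ s.
have c00 : 0 < c0 by rewrite mulr_gt0// powR_gt0.
pose C1 := c0 * 2 `^ s * K * D * 2 `^ (s - 1).
have C10 : 0 < C1 by rewrite /C1 !mulr_gt0// powR_gt0.
exists (C1 + C1) => [|G mG G0]; first by rewrite addr_gt0.
(* [V t] is the superlevel set of the maximal function over the countable family, and [W] below is
   its layer cake sum, discretized to dyadic levels. *)
pose V t := \bigcup_(i in
  [set i | ((t * m (c i) (r i))%:E < \int[mu]_(x in B (c i) (r i)) (G x)%:E)%E])
  B (c i) (r i).
have mV t : measurable (V t) by apply: bigcup_measurable => *.
pose w b n (x : X) : \bar R := (c0 * (2 * dyad R b n) `^ s * \1_(V (dyad R b n)) x)%:E.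
have w0 b n x : (0 <= w b n x)%E.
  by rewrite lee_fin !mulr_ge0 ?powR_ge0// ltW.
have mw b n : measurable_fun setT (w b n).
  by apply/measurable_EFinP; apply: measurable_funM => //; exact: measurable_indic.
pose W b x := (\sum_(n <oo) w b n x)%E.
have W0 b x : (0 <= W b x)%E by apply: nneseries_ge0 => n _ _; exact: w0.
have mW b : measurable_fun setT (W b).
  by apply: ge0_emeasurable_sum => // n x _ _.
have intW b : (\int[mu]_x W b x <= C1%:E * \int[mu]_x (G x `^ s)%:E)%E.
  rewrite integral_nneseries//.
  apply: lime_le.
    by apply: is_cvg_nneseries => n _ _; apply: integral_ge0 => x _; exact: w0.
  apply: nearW => N; rewrite big_mkord.
  (* Marcinkiewicz interpolation: the weak type bound turns [t^s] into [t^(s-1)] times the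
     truncation of [G], and summing over dyadic [t < 2 * G x] gives a multiple of
     [(2 * G x)^(s-1) * G x]. *)
  pose g (n : nat) x := (c0 * 2 `^ s * K * (dyad R b n `^ (s - 1) *
     (dyad R b n < 2 * G x)%R%:R) * G x)%:E.
  have g0 n x : (0 <= g n x)%E.
    by rewrite lee_fin !mulr_ge0 ?powR_ge0// ltW.
  have mg n : measurable_fun setT (g n).
    apply/measurable_EFinP.
    rewrite (_ : (fun _ => _) = (fun x => c0 * 2 `^ s * K * dyad R b n `^ (s - 1) *
      (G x * (dyad R b n < 2 * G x)%R%:R))); last first.
      by apply/funext => x; ring.
    by apply: measurable_funM => //; exact: measurable_trunc.
  apply: (@le_trans _ _ (\sum_(n < N) \int[mu]_x g n x)%E).
    apply: lee_sum => n _; set t := dyad R b n.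
    have t0 : 0 < t by exact: dyad_gt0.
    rewrite /w -/t.
    have c2t : 0 <= c0 * (2 * t) `^ s by rewrite mulr_ge0 ?powR_ge0// ltW.
    rewrite ge0_integralZ_EFin//.
    rewrite integral_indic// setIT.
    have := weak c r t G r0 t0 mG G0; rewrite -/(V t) => wk.
    have -> : c0 * (2 * t) `^ s = c0 * 2 `^ s * t `^ (s - 1) * t.
      rewrite powRM ?(ltW t0)// -!mulrA; do 2 congr (_ * _).
      by rewrite (powR_subr1 _ t0).
    rewrite EFinM -muleA.
    apply: (@le_trans _ _ ((c0 * 2 `^ s * t `^ (s - 1))%:E *
      (K%:E * \int[mu]_x (G x * (t < 2 * G x)%R%:R)%:E))%E).
      by rewrite lee_wpmul2l// lee_fin !mulr_ge0 ?powR_ge0// ltW.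
    rewrite muleA -EFinM -ge0_integralZ_EFin//; last 3 first.
    - by rewrite !mulr_ge0 ?powR_ge0// ltW.
    - exact: measurable_trunc.
    - by move=> x; rewrite mulr_ge0.
    apply: ge0_le_integralT => x.
      by rewrite lee_fin !mulr_ge0 ?powR_ge0// ltW.
    rewrite lee_fin /g -/t le_eqVlt; apply/orP; left; apply/eqP; ring.
  rewrite -ge0_integral_sum// -ge0_integralZ_EFin//; last 3 first.
  - exact: ltW.
  - exact: (measurableT_comp (measurable_powR _)).
  - by move=> x; rewrite powR_ge0.
  apply: ge0_le_integralT => x; first by apply: sume_ge0.
  rewrite sumEFin lee_fin -mulr_suml -mulr_sumr.
  have G20 : 0 <= 2 * G x by rewrite mulr_ge0.
  apply: (@le_trans _ _ (c0 * 2 `^ s * K * (D * (2 * G x) `^ (s - 1)) * G x)).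
    by rewrite ler_wpM2r// ler_wpM2l ?geo// !mulr_ge0 ?powR_ge0// ltW.
  rewrite powRM// /C1 -!mulrA; do 6 (apply: ler_wpM2l; first by rewrite ?powR_ge0// ltW).
  have := G0 x; rewrite le0r => /predU1P[->|/powR_subr1 ->//].
  by rewrite mulr0; exact: powR_ge0.
exists (fun x => W true x + W false x)%E; split.
- exact: emeasurable_funD.
- by move=> x; rewrite adde_ge0.
- rewrite ge0_integralD// EFinD ge0_muleDl ?lee_fin ?(ltW C10)//.
  exact: leeD.
(* If the average exceeded [v^(1/s)], then [x] would lie in [V t] for a dyadic [t] within a factor 2
   of [v^(1/s) / L], and this single term of [W x] would exceed [v]. *)
move=> x rho v rho0 v0 Wv; rewrite leNgt; apply/negP => Gv.
have [n [sub mn]] := cover x rho rho0.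
have vL : 0 < v `^ s^-1 / L by rewrite divr_gt0 ?powR_gt0.
have [b [k /andP[k1 k2]]] := ex_dyad vL.
have xV : V (dyad R b k) x.
  exists n => /=; last exact/sub/(qball_center hX).
  apply: (@lt_le_trans _ _ (\int[mu]_(y in B x rho) (G y)%:E)%E); last first.
    apply: ge0_subset_integral => //; last by move=> y _; rewrite lee_fin.
    by apply/measurable_EFinP; exact: measurable_funTS.
  apply: le_lt_trans Gv; rewrite lee_fin.
  apply: (@le_trans _ _ (v `^ s^-1 / L * (L * m x rho))).
    by apply: ler_pM => //; [rewrite ltW// dyad_gt0|exact: (ball_measure_ge0 hX)|exact: ltW].
  by rewrite mulrA divfK// gt_eqF.
suff : (v%:E < W true x + W false x)%E by rewrite ltNge Wv.
have : (v%:E < w b k x)%E.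
  rewrite /w indicE mem_set// mulr1 lte_fin.
  apply: (@lt_le_trans _ _ (c0 * (v `^ s^-1 / L) `^ s)); last first.
    rewrite ler_wpM2l ?(ltW c00)// ge0_ler_powR ?nnegrE ?(ltW vL) ?(ltW s0)//.
    by rewrite mulr_ge0// ltW// dyad_gt0.
  rewrite /c0 -mulrA -powRM ?(ltW L0) ?(ltW vL)//.
  have -> : L * (v `^ s^-1 / L) = v `^ s^-1 by rewrite mulrC divfK ?gt_eqF.
  by rewrite -powRrM mulVf ?gt_eqF// powRr1 ?(ltW v0)//; lra.
move=> /lt_le_trans; apply.
apply: (@le_trans _ _ (W b x)).
  apply: le_trans (@nneseries_lim_ge _ _ xpredT 0 k.+1 _).
    by rewrite big_mkord big_ord_recr/= leeDr// sume_ge0.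
  by move=> i _ _; exact: w0.
by case: (b); rewrite ?leeDl ?leeDr.
Qed.
End maximal.

(** * Consequences of reverse doubling *)

Section reverse_doubling.
Context (R : realType) (disp : measure_display) (X : measurableType disp).
Context (dist : X -> X -> R) (mu : {measure set X -> \bar R}).
Context (hR : reverse_doubling_space dist mu).
Local Notation B := (qball dist).
Local Notation m := (ball_measure dist mu).
Let hX := rds_homogeneous hR.

Let mB x r : measurable (B x r). Proof. exact: (measurable_qball hX). Qed.
Hint Resolve mB : core.

(** In an unbounded space every ball is proper, so each doubling of the radius multiplies the
    measure by at least [g^-1]; then [m x 1 <= g^n * M] for all [n], against its positivity. *)
Lemma bounded_of_ball_measure_le x (M : R) : (forall r, 0 < r -> m x r <= M) ->
  exists2 r, 0 < r & forall y, dist x y < r.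
Proof.
move=> mM; apply: contrapT => nbd.
have [g [g0 g1 rev]] := rds_reverse_doubling hR.
have proper r : 0 < r -> B x r `<` [set: X].
  by move=> r0; split => // sub; apply: nbd; exists r => // y; exact: sub.
have step n : m x 1 <= g ^+ n * m x (2 ^+ n).
  elim: n => [|n IH]; first by rewrite !expr0 mul1r.
  apply: (le_trans IH); rewrite exprSr -mulrA ler_pM2l ?exprn_gt0//.
  have := rev x (2 ^+ n.+1) (exprn_gt0 _ _) (proper _ (exprn_gt0 _ _)).
  rewrite [in qball _ _ (_ / _)]exprSr mulfK ?pnatr_eq0//.
  by rewrite !(ball_measureE hX) -EFinM lee_fin; exact.
have /cvgr_lt/(_ (m x 1)) : geometric M g @ \oo --> (0 : R).
  by apply: cvg_geometric; rewrite gtr0_norm.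
move=> /(_ (ball_measure_gt0 hX _ ltr01))[n _ /(_ n (leqnn _))].
rewrite /= ltNge; apply/negP; rewrite negbK; apply: (le_trans (step n)).
by rewrite mulrC ler_pM2r ?exprn_gt0// mM// exprn_gt0.
Qed.

(** A level set with unbounded distances would force [m x r <= t] for every [r], hence a bounded
    space by the previous lemma. So the distances have a supremum; twice the distance to a point
    beyond half of it gives the radius, and doubling gives the measure. *)
Lemma level_set_sub_qball : exists2 K : R, 1 <= K & forall x t, 0 < t ->
  exists2 r, 0 < r & [set y | 0 < m x (dist x y) < t] `<=` B x r /\
    ([set y | 0 < m x (dist x y) < t] !=set0 -> m x r <= K * t).
Proof.
have [K K1 scaleK] := ball_measure_scale hX 2; exists K => // x t t0.
set E := [set y | _].
have [->|/set0P E0] := eqVneq E set0.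
  by exists 1 => //; split => // -[].
have distE y : E y -> 0 < dist x y.
  move=> /andP[m0 _]; rewrite ltNge; apply/negP => d0.
  by move: m0; rewrite /ball_measure (qball_le0 hX)// measure0 ltxx.
have ubE : has_ubound [set dist x y | y in E].
  have [//|nub] := pselect (has_ubound [set dist x y | y in E]).
  have [|r r0 xr] := @bounded_of_ball_measure_le x t.
    move=> r r0; apply: contrapT => /negP; rewrite -ltNge => tr.
    apply: nub; exists r => _ [y /andP[_ yt] <-]; rewrite leNgt; apply/negP => ry.
    have := ball_measure_le hX x (ltW ry); lra.
  by exists r => _ [y _ <-]; exact: ltW.
have supE : has_sup [set dist x y | y in E].
  by split => //; case: E0 => y Ey; exists (dist x y); exists y.
have sup0 : 0 < sup [set dist x y | y in E].
  case: E0 => y Ey; apply: (lt_le_trans (distE _ Ey)).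
  by apply: ub_le_sup => //; exists y.
have [_ [y Ey <-]] := sup_adherent (divr_gt0 sup0 (ltr0n _ 2)) supE.
have : forall z, E z -> dist x z <= sup [set dist x y | y in E].
  by move=> z Ez; apply: ub_le_sup => //; exists z.
move: (sup _) => S zS dy.
exists (2 * dist x y); first by rewrite mulr_gt0// distE.
split=> [z /zS zS'|_]; first by rewrite /qball/=; lra.
apply: (le_trans (scaleK _ _ (distE _ Ey))).
by rewrite ler_pM2l; [case/andP: Ey => _ /ltW|lra].
Qed.
End reverse_doubling.

(** * Hedberg's inequality *)

(** Gives both halves of a dyadic sum the same ratio: large scales decay under a negative exponent,
    small scales under a positive one. *)
Lemma dyad_powR_le (R : realType) (b : bool) (n : nat) (k a : R) : 0 < k ->
  (if b then a <= - k else k <= a) -> dyad R b n `^ a <= (2 `^ (- k)) ^+ n.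
Proof.
move=> k0; have e n' : (2 `^ (- k) : R) ^+ n' = 2 `^ (- k * n'%:R).
  by rewrite powRrM powR_mulrn// powR_ge0.
have two1 : (1 : R) <= 2 by lra.
rewrite e /dyad -powR_mulrn//; case: b => ak.
  by rewrite -powRrM; apply: ler_powR => //; rewrite mulrC ler_wpM2r.
rewrite -powR_inv1 ?powR_ge0// -!powRrM; apply: ler_powR => //.
by have := ler_wpM2r (ler0n R n) ak; lra.
Qed.

Section hedberg.
Context (R : realType) (disp : measure_display) (X : measurableType disp).
Context (dist : X -> X -> R) (mu : {measure set X -> \bar R}).
Context (hR : reverse_doubling_space dist mu).
Local Notation B := (qball dist).
Local Notation m := (ball_measure dist mu).
Let hX := rds_homogeneous hR.

Let mB x r : measurable (B x r). Proof. exact: (measurable_qball hX). Qed.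
Hint Resolve mB : core.

(* Hedberg's argument, with annuli cut out by the size of the kernel instead of
   the distance; [w = t^-1] balances the inner and the outer sums. *)
Lemma frac_integral_le (eta th : R) : 0 < eta < 1 -> 0 < th ->
  exists2 C : R, 0 < C &
  forall (h : X -> R) (x : X) (P w A : R), measurable_fun setT h ->
    (forall y, 0 <= h y) -> 1 <= P -> th <= P^-1 - eta -> 0 < w -> 0 <= A ->
    (forall r, 0 < r ->
      (\int[mu]_(y in B x r) (h y)%:E <= (A * w `^ P^-1 * m x r)%:E)%E) ->
    (forall r, 0 < r ->
      (\int[mu]_(y in B x r) (h y)%:E <= (A * m x r `^ (1 - P^-1))%:E)%E) ->
    (\int[mu]_y (h y * (m x (dist x y) `^ (1 - eta))^-1)%:E <=
      (C * A * w `^ (P^-1 - eta))%:E)%E.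
Proof.
move=> /andP[eta0 eta1] th0.
have [K K1 level] := level_set_sub_qball hR.
(* The inner sum decays with rate [eta] and the outer one with rate [P^-1 - eta >= th]. A common
   rate independent of [P] is essential, as [P] will be [p x]. *)
pose k := Num.min eta th; pose z : R := 2 `^ (- k).
have k0 : 0 < k by rewrite lt_min eta0.
have z0 : 0 < z by rewrite powR_gt0.
have z1 : z < 1.
  have two1 : (1 : R) < 2 by lra.
  by rewrite /z powRN invf_lt1 ?powR_gt0// -[ltLHS](congr1 (@^~ k) (powR1 R))
    gt0_ltr_powR ?nnegrE.
have K40 : 0 < 4 * K by lra.
have K41 : 1 <= 4 * K by lra.
exists (8 * K / (1 - z)) => [|h x P w A mh h0 P1 thP w0 A0 int1 int2].
  by rewrite divr_gt0//; lra.
have P0 : 0 < P by lra.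
have iP1 : P^-1 <= 1 by rewrite invf_le1.
have iP0 : 0 < P^-1 by rewrite invr_gt0.
pose t := w^-1; have t0 : 0 < t by rewrite invr_gt0.
have wt a : w `^ a = t `^ (- a).
  by rewrite /t -powR_inv1 ?(ltW w0)// -powRrM mulN1r opprK.
pose E s := [set y | 0 < m x (dist x y) < s].
have mphi := measurable_ball_measure_dist hX x.
have mE s : measurable (E s).
  rewrite (_ : E s = [set y | 0 < m x (dist x y)] `&` [set y | m x (dist x y) < s]).
    by apply: measurableI; exact: measurable_lt_set.
  apply/seteqP; split => [y /andP[]//|y [/= y0 ys]].
  by rewrite /E/= y0.
pose d b n := dyad R b n.
have d0 b n : 0 < d b n by exact: dyad_gt0.
(* On the annulus [d * t < m <= 2 * d * t] the kernel is at most [(d * t)^(eta - 1)]. The indicator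
   is that of a whole level set, which lies in a ball of comparable measure; 4 instead of 2 accounts
   for its strict inequality. *)
pose F b n y := ((d b n * t) `^ (eta - 1) * (h y * \1_(E (4 * d b n * t)) y))%:E.
have F0 b n y : (0 <= F b n y)%E by rewrite lee_fin !mulr_ge0 ?powR_ge0.
have mhE s : measurable_fun setT (fun y => h y * \1_(E s) y).
  by apply: measurable_funM => //; exact: measurable_indic.
have mF b n : measurable_fun setT (F b n).
  by apply/measurable_EFinP; apply: measurable_funM => //.
pose c := 4 * K * A * w `^ (P^-1 - eta).
have intF b n : (\int[mu]_y F b n y <= (c * z ^+ n)%:E)%E.
  have dt0 : 0 < d b n * t by rewrite mulr_gt0.
  rewrite ge0_integralZ_EFin ?powR_ge0//; last by move=> y; rewrite mulr_ge0.
  have s0 : 0 < 4 * d b n * t by rewrite -mulrA mulr_gt0.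
  have [r r0 [Er rK]] := level x _ s0.
  have {}rK : E (4 * d b n * t) !=set0 -> m x r <= 4 * K * (d b n * t).
    by move=> /rK /le_trans; apply; rewrite le_eqVlt; apply/orP; left; apply/eqP; ring.
  have [Es0|/set0P/rK{}rK] := eqVneq (E (4 * d b n * t)) set0.
    rewrite Es0; under eq_integral do rewrite indic0 mulr0.
    rewrite integral0 mule0 lee_fin /c !mulr_ge0 ?powR_ge0 ?exprn_ge0//; lra.
  have intE := ge0_integralM_indic_le mu Er h0.
  have goal_of (v : R) : (\int[mu]_(y in B x r) (h y)%:E <= v%:E)%E ->
      (d b n * t) `^ (eta - 1) * v <= c * z ^+ n ->
      ((((d b n * t) `^ (eta - 1))%:E *
        \int[mu]_y (h y * \1_(E (4 * d b n * t)) y)%:E) <= (c * z ^+ n)%:E)%E.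
    move=> hv vc; apply: (@le_trans _ _ ((d b n * t) `^ (eta - 1) * v)%:E).
      by rewrite EFinM lee_wpmul2l ?lee_fin ?powR_ge0// (le_trans intE).
    by rewrite lee_fin.
  have m0 := ball_measure_ge0 hX x r.
  have dzT : b -> d b n `^ (eta - P^-1) <= z ^+ n.
    move=> bT; apply: dyad_powR_le => //; rewrite bT.
    have : k <= th by rewrite ge_min lexx orbT.
    lra.
  have dzF : ~~ b -> d b n `^ eta <= z ^+ n.
    by move=> bF; apply: dyad_powR_le => //; rewrite (negbTE bF) ge_min lexx.
  (* Outer scales use the bound by a power of the measure, inner scales the bound by [w]. *)
  have /orP[/dzT dz|/dzF dz] : b || ~~ b by case: (b).
    apply: (goal_of _ (int2 _ r0)).
    apply: (@le_trans _ _ ((d b n * t) `^ (eta - 1) *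
        (A * (4 * K * (d b n * t) `^ (1 - P^-1))))).
      rewrite ler_wpM2l ?powR_ge0// ler_wpM2l//.
      apply: (@le_trans _ _ ((4 * K * (d b n * t)) `^ (1 - P^-1))).
        rewrite ge0_ler_powR ?nnegrE ?subr_ge0//.
        by rewrite mulr_ge0 ?(ltW dt0)//; lra.
      rewrite powRM ?(ltW dt0) ?(ltW K40)// ler_wpM2r ?powR_ge0//.
      rewrite -[leRHS]powRr1 ?(ltW K40)//; apply: ler_powR => //; lra.
    have -> : (d b n * t) `^ (eta - 1) * (A * (4 * K * (d b n * t) `^ (1 - P^-1)))
        = c * d b n `^ (eta - P^-1).
      rewrite /c wt (_ : - (P^-1 - eta) = eta - P^-1); last by ring.
      have : (d b n * t) `^ (eta - 1) * (d b n * t) `^ (1 - P^-1)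
          = d b n `^ (eta - P^-1) * t `^ (eta - P^-1).
        rewrite -powRD; last by rewrite (gt_eqF dt0) implybT.
        by rewrite -powRM ?ltW//; congr (_ `^ _); ring.
      move: (_ `^ (eta - 1)) (_ `^ (1 - P^-1)) => u v uv.
      rewrite [LHS](_ : _ = 4 * K * A * (u * v)); last by ring.
      by rewrite uv; ring.
    by rewrite ler_wpM2l// /c !mulr_ge0 ?powR_ge0//; lra.
  apply: (goal_of _ (int1 _ r0)).
  apply: (@le_trans _ _ ((d b n * t) `^ (eta - 1) *
      (A * w `^ P^-1 * (4 * K * (d b n * t))))).
    by rewrite ler_wpM2l ?powR_ge0// ler_wpM2l// mulr_ge0 ?powR_ge0.
  have -> : (d b n * t) `^ (eta - 1) * (A * w `^ P^-1 * (4 * K * (d b n * t)))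
      = c * d b n `^ eta.
    have : (d b n * t) `^ (eta - 1) * (d b n * t) = d b n `^ eta * t `^ eta.
      by rewrite powR_subr1// powRM ?(ltW (d0 _ _)) ?(ltW t0).
    have -> : c = 4 * K * A * (w `^ P^-1 * t `^ eta).
      rewrite /c !wt -powRD; last by rewrite (gt_eqF t0) implybT.
      by congr (_ * _ `^ _); ring.
    move: (_ `^ (eta - 1)) (w `^ _) => u v uv.
    rewrite [LHS](_ : _ = 4 * K * A * v * (u * (d b n * t))); last by ring.
    by rewrite uv; ring.
  by rewrite ler_wpM2l// /c !mulr_ge0 ?powR_ge0//; lra.
have c0 : 0 <= c by rewrite /c !mulr_ge0 ?powR_ge0//; lra.
have -> : 8 * K / (1 - z) * A * w `^ (P^-1 - eta) = (c + c) / (1 - z).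
  by rewrite /c; ring.
apply: (@ge0_integral_geometric_le _ _ _ _ _ (fun n y => F true n y + F false n y)%E).
- by move=> y; rewrite lee_fin mulr_ge0// invr_ge0 powR_ge0.
- by move=> n y; rewrite adde_ge0.
- by move=> n; exact: emeasurable_funD.
- move=> y.
  have [phi0|phi0] := ltP 0 (m x (dist x y)); last first.
    (* This is the diagonal [y = x], where the kernel is the inverse of 0, that is 0. *)
    exists 0%N; have -> : m x (dist x y) = 0.
      by apply/eqP; rewrite eq_le phi0 ball_measure_ge0.
    by rewrite powR0 ?subr_eq0 ?gt_eqF// invr0 mulr0 adde_ge0.
  have [b [n /andP[n1 n2]]] := ex_dyad (divr_gt0 phi0 t0).
  exists n; apply: (@le_trans _ _ (F b n y)); last first.
    by case: (b); rewrite ?leeDl ?leeDr.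
  rewrite /F lee_fin indicE mem_set; last first.
    rewrite /E /= phi0/=; apply: (@le_lt_trans _ _ (2 * d b n * t)).
      by rewrite -ler_pdivrMr.
    by rewrite ltr_pM2r// ltr_pM2r//; lra.
  rewrite mulr1 mulrC ler_wpM2r// -powRN opprB.
  rewrite -!(opprB 1 eta) !powRN lef_pV2 ?posrE ?powR_gt0 ?mulr_gt0//.
  by rewrite ge0_ler_powR ?nnegrE ?(ltW phi0) ?mulr_ge0 ?(ltW (d0 _ _)) ?(ltW t0)
    ?subr_ge0 ?(ltW eta1)// ltW// -ltr_pdivlMr.
- by rewrite addr_ge0.
- by rewrite z0.
- move=> n; rewrite ge0_integralD// mulrDl EFinD; exact: leeD.
Qed.
End hedberg.

(** * Log-Hoelder exponents *)

Lemma powR_expR (R : realType) (a x : R) : 0 < a -> a `^ x = expR (x * ln a).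
Proof. by move=> a0; rewrite /powR gt_eqF. Qed.

Lemma expR1_gt1 (R : realType) : 1 < expR 1 :> R.
Proof. by rewrite expR_gt1. Qed.

Lemma ln_ge1 (R : realType) (w : R) : expR 1 <= w -> 1 <= ln w.
Proof.
move=> w1; rewrite -[leLHS]expRK ler_ln// posrE ?expR_gt0//.
by rewrite (lt_le_trans _ w1)// expR_gt0.
Qed.

(* If [u] is not smaller than a power of [w^-1], then the exponents are close
   enough for the two powers to be comparable. *)
Lemma powR_exponent_swap (R : realType) (u a b lo K M w : R) :
  0 <= u <= 1 -> 0 < lo -> lo <= a -> lo <= b -> expR 1 <= w -> 0 <= K ->
  0 < M -> `|a - b| <= K / ln w ->
  u `^ a <= expR (M / lo * K) * u `^ b + w `^ (- M).
Proof.
move=> /andP[u0 u1] lo0 loa lob w1 K0 M0 ab.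
have w0 : 0 < w by rewrite (lt_le_trans _ w1)// expR_gt0.
have lnw := ln_ge1 w1.
have a0 : 0 < a by lra.
move: u0; rewrite le0r => /predU1P[->|u0].
  by rewrite powR0 ?gt_eqF// addr_ge0 ?mulr_ge0 ?powR_ge0 ?expR_ge0.
have l0 : ln u <= 0 by rewrite ln_le0.
rewrite !powR_expR//; set l := ln u in l0 *.
have Ml0 : 0 < M / lo by rewrite divr_gt0.
(* The threshold is [u = w^(-M/lo)]. Above it, the closeness of [a] and [b] makes the two powers
   comparable; below it, [u^a <= u^lo <= w^(-M)]. *)
have [h|h] := leP (- (M / lo) * ln w) l.
  rewrite -[leLHS]addr0 lerD ?expR_ge0// -expRD ler_expR.
  suff : (a - b) * l <= M / lo * K by lra.
  apply: (@le_trans _ _ (`|a - b| * - l)).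
    by rewrite (le_trans (ler_norm _))// normrM (ler0_norm l0).
  apply: (@le_trans _ _ (K / ln w * (M / lo * ln w))).
    by rewrite ler_pM//; lra.
  have -> : K / ln w * (M / lo * ln w) = M / lo * K.
    by field; rewrite !gt_eqF//; lra.
  by [].
rewrite -[leLHS]add0r lerD ?mulr_ge0 ?expR_ge0// ler_expR.
have : a * l <= lo * l by rewrite ler_wnM2r.
have : lo * l <= lo * (- (M / lo) * ln w) by rewrite ler_pM2l// ltW.
have -> : lo * (- (M / lo) * ln w) = - M * ln w.
  by field; rewrite gt_eqF.
lra.
Qed.

Section log_hoelder.
Context (R : realType) (disp : measure_display) (X : measurableType disp).
Context (dist : X -> X -> R) (mu : {measure set X -> \bar R}).
Context (hX : homogeneous_space dist mu).
Local Notation B := (qball dist).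
Local Notation m := (ball_measure dist mu).

Let mB x r : measurable (B x r). Proof. exact: (measurable_qball hX). Qed.
Hint Resolve mB : core.

(** If [u x > M], the modulus of continuity keeps [u > M] on a ball around [x], and balls have
    positive measure. The radius makes [|C0| / - ln r] smaller than [u x - M]. *)
Lemma LH0_ae_le (u : X -> R) (M : R) : LH0 dist u ->
  {ae mu, forall x, u x <= M} -> forall x, u x <= M.
Proof.
move=> [C0 hu] aeu x; rewrite leNgt; apply/negP => Mu.
pose e := u x - M; have e0 : 0 < e by rewrite subr_gt0.
pose r : R := Num.min (1 / 2) (expR (- ((`|C0| + 1) / e))).
have r0 : 0 < r by rewrite lt_min expR_gt0; lra.
have [N [mN N0 sub]] := aeu.
have BN : B x r `<=` N.
  move=> y; rewrite /qball/= => xy; apply: sub => /= yM.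
  have yx : x <> y by move=> yx; rewrite yx ltNge yM in Mu.
  have d0 := dist_gt0 hX yx.
  move: xy; rewrite lt_min => /andP[d12 de].
  have := hu x y yx d12.
  have lnd : ln (dist x y) < - ((`|C0| + 1) / e).
    by rewrite -ltr_expR lnK.
  have L0 : 0 < - ln (dist x y).
    have : 0 <= (`|C0| + 1) / e by rewrite divr_ge0 ?(ltW e0)// addr_ge0.
    lra.
  have -> : - C0 / ln (dist x y) = C0 / - ln (dist x y) by rewrite mulNr invrN mulrN.
  move/(le_trans (ler_norm _)); rewrite ler_pdivlMr// => h.
  have : `|C0| + 1 < e * - ln (dist x y) by rewrite mulrC -ltr_pdivrMr//; lra.
  have : e * - ln (dist x y) <= (u x - u y) * - ln (dist x y).
    by rewrite ler_pM2r// /e; lra.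
  have := ler_norm C0; lra.
have := hs_ball_gt0 hX x r0.
rewrite ltNge => /negP; apply.
by rewrite -N0 le_measure// inE.
Qed.

(** Doubling with the power of [K] kept explicit: this is the polynomial growth of the measure,
    which [ball_measure_scale] hides. *)
Lemma ball_measure_iter : exists2 K : R, 1 <= K & forall n x r, 0 < r ->
  m x (2 ^+ n * r) <= K ^+ n * m x r.
Proof.
have [K K1 scaleK] := ball_measure_scale hX 2; exists K => //.
have K0 : 0 < K by lra.
elim=> [|n IH] x r r0; first by rewrite !mul1r.
rewrite !exprS -!mulrA; apply: (le_trans (scaleK _ _ _)).
  by rewrite mulr_gt0// exprn_gt0.
by rewrite ler_pM2l// IH.
Qed.

Context (x0 : X).
Local Notation om x := (expR 1 + dist x x0).

Let om1 x : expR 1 <= om x.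
Proof. by rewrite lerDl (dist_ge0 hX). Qed.

Let om_gt1 x : 1 < om x.
Proof. exact: lt_le_trans (expR1_gt1 R) (om1 x). Qed.

Let om0 x : 0 < om x.
Proof. exact: lt_trans (om_gt1 x). Qed.

Lemma measurable_weight (M : R) : measurable_fun setT (fun y => om y `^ (- M)).
Proof.
apply: (measurableT_comp (measurable_powR _)) => //.
apply: measurable_funD => //.
rewrite (_ : (fun _ => _) = dist x0); first exact: (measurable_dist hX).
by apply/funext => y; rewrite (dist_sym hX).
Qed.

(** On the annulus where [om y] is about [2^k], the measure grows at most like [K^k]; an exponent
    [N] with [2 * K <= 2^N] leaves a geometric series of ratio at most 1/2. *)
Lemma weight_integrable : exists2 M : R, 0 < M &
  exists2 K : R, 0 < K & (\int[mu]_y (om y `^ (- M))%:E <= K%:E)%E.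
Proof.
have [K K1 iterK] := ball_measure_iter.
have K0 : 0 < K by lra.
have [n Kn] := ex_exp2_ge (2 * K).
pose N := n.+1; have N2 : 2 * K <= 2 ^+ N.
  by apply: (le_trans Kn); rewrite ler_eXn2l//; lra.
have N0 : (0 : R) < 2 ^+ N by rewrite exprn_gt0.
have m0 : 0 < m x0 1 by exact: (ball_measure_gt0 hX).
exists N%:R; first by rewrite ltr0n.
exists ((2 ^+ N * m x0 1) / (1 - 2^-1)); first by rewrite divr_gt0 ?mulr_gt0//; lra.
pose F (k : nat) (y : X) : \bar R := (2 ^+ N * (2 ^- N) ^+ k * \1_(B x0 (2 ^+ k)) y)%:E.
have F0 k y : (0 <= F k y)%E.
  by rewrite lee_fin !mulr_ge0// ?exprn_ge0// invr_ge0 ltW.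
apply: (@ge0_integral_geometric_le _ _ _ _ _ F) => //.
- by move=> y; rewrite lee_fin powR_ge0.
- move=> k; apply/measurable_EFinP; exact: measurable_funM.
- move=> y; have [k /andP[k1 k2]] := ex_exp2_between (om_gt1 y).
  exists k.+1; rewrite lee_fin indicE mem_set/=; last first.
    rewrite /qball/= (dist_sym hX) (lt_le_trans _ k2)// ltrDr expR_gt0//.
  rewrite mulr1 powRN powR_mulrn ?(ltW (om0 _))//.
  have -> : 2 ^+ N * (2 ^- N) ^+ k.+1 = ((2 ^+ k)^-1) ^+ N :> R.
    rewrite exprS mulrA divff ?gt_eqF// mul1r -!exprVn -!exprM mulnC.
    by [].
  rewrite -(exprVn (om y)) lerXn2r ?nnegrE ?invr_ge0 ?exprn_ge0 ?(ltW (om0 _))//.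
  by rewrite lef_pV2 ?posrE ?exprn_gt0// ltW.
- by rewrite mulr_ge0 ?ltW.
- lra.
- move=> k; rewrite ge0_integralZ_EFin//.
  rewrite integral_indic// setIT (ball_measureE hX) -EFinM lee_fin.
  have := iterK k x0 1 ltr01; rewrite mulr1 => mk.
  apply: (@le_trans _ _ (2 ^+ N * (2 ^- N) ^+ k * (K ^+ k * m x0 1))).
    by rewrite ler_wpM2l// mulr_ge0 ?exprn_ge0 ?invr_ge0// ltW.
  rewrite -!mulrA ler_pM2l// mulrA mulrC ler_pM2l// -exprMn.
  have base : 2 ^- N * K <= 2^-1 by rewrite mulrC ler_pdivrMr//; lra.
  by rewrite lerXn2r ?nnegrE ?mulr_ge0 ?invr_ge0 ?(ltW N0) ?(ltW K0).
Qed.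

(** Polynomial growth bounds [- ln (m x r)] by a multiple of [ln u], plus a constant, where [u] is
    about [om x / r]. Of its two logarithms, [ln (om x)] is absorbed by the decay of [p] at infinity
    and [- ln r] by [LH0]. *)
Lemma log_oscillation (p : X -> R) (pinf Ci D : R) : LH0 dist p ->
  (forall x, `|p x - pinf| <= Ci / ln (om x)) -> 0 <= Ci ->
  (forall x y, `|p x - p y| <= D) ->
  exists2 K : R, 0 <= K & forall x y r, 0 < r -> dist x y < r ->
    `|p x - p y| * (- ln (m x r)) <= K.
Proof.
move=> [C0 hp] hinf Ci0 hD.
have [A0 A01 tri] := qm_tri (hs_quasi_metric hX).
have A00 : 0 < A0 by lra.
have [K K1 iterK] := ball_measure_iter.
have K0 : 0 < K by lra.
have D0 : 0 <= D by rewrite (le_trans _ (hD x0 x0)).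
have lnK0 : 0 <= ln K by rewrite ln_ge0.
have ln2 : (0 : R) < ln 2 by rewrite ln_gt0//; lra.
have lnA0 : 0 <= ln A0 by rewrite ln_ge0.
have ln2A0 : 0 <= ln (2 * A0) by rewrite ln_ge0//; lra.
have m0 : 0 < m x0 1 by exact: (ball_measure_gt0 hX).
(* The bound on [|p x - p y| * ln u], [u] being the ratio of radii below. *)
pose K' := D * ln 2 + D * ln (2 * A0 * A0) + D * ln A0 +
  (Ci + Ci * (1 + ln (2 * A0))) + (D + `|C0|).
have lnAA : 0 <= ln (2 * A0 * A0) by rewrite ln_ge0//; nra.
have Ci' : 0 <= Ci * (1 + ln (2 * A0)) by rewrite mulr_ge0// addr_ge0.
have Dln2 : 0 <= D * ln 2 by rewrite mulr_ge0// ltW.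
have DlnA : 0 <= D * ln A0 by rewrite mulr_ge0.
have DlnAA : 0 <= D * ln (2 * A0 * A0) by rewrite mulr_ge0.
have C00 : 0 <= `|C0| by [].
have K'0 : 0 <= K' by rewrite /K'; lra.
exists (ln K / ln 2 * K' + D * (ln K + `|ln (m x0 1)|)).
  by rewrite addr_ge0// mulr_ge0 ?addr_ge0// divr_ge0// ltW.
move=> x y r r0 xy; set d := `|p x - p y|.
have d0 : 0 <= d by exact: normr_ge0.
have dD : d <= D by exact: hD.
have mr0 : 0 < m x r by exact: (ball_measure_gt0 hX).
(* The ball of radius [u * r] about [x] contains [B x0 1], so doubling bounds [m x r] below by a
   power of [u^-1]. The 2 ensures [u > 1], as [ex_exp2_between] requires. *)
pose u := Num.max 2 (A0 * om x / r).
have u1 : 1 < u by rewrite lt_max; apply/orP; left; lra.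
have lnomx := ln_ge1 (om1 x); have lnomy := ln_ge1 (om1 y).
have omxy : om x <= A0 * (r + om y).
  have : dist x x0 <= A0 * (r + dist y x0).
    apply: (le_trans (tri _ _ y)); rewrite ler_pM2l// lerD ?(ltW xy)//.
    by rewrite (dist_sym hX).
  have : expR 1 <= A0 * expR 1 :> R by rewrite ler_peMl// expR_ge0.
  by rewrite !mulrDr; lra.
have dlog (v : R) : 0 <= v -> d * v <= D * v by move=> v0; rewrite ler_wpM2r.
have du : d * ln u <= K'.
  rewrite /u; have [_|] := leP (A0 * om x / r) 2.
    by have := dlog _ (ltW ln2); rewrite /K'; lra.
  rewrite ltr_pdivlMr// => ur.
  (* If [r] dominates [om y], then [om x / r] is bounded. Otherwise [om x <= 2 * A0 * om y], so the
     decay of [p] at [y] can be measured by [ln (om x)] too. *)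
  have [ry|ry] := leP (om y) r.
    have uAA : A0 * om x / r <= 2 * A0 * A0.
      rewrite ler_pdivrMr//; have : om x <= A0 * (r + r).
        by apply: (le_trans omxy); rewrite ler_pM2l// lerD2l.
      by rewrite -(ler_pM2l A00); lra.
    have u0 : 0 < A0 * om x / r by rewrite divr_gt0// mulr_gt0.
    have := dlog _ lnAA.
    have : d * ln (A0 * om x / r) <= d * ln (2 * A0 * A0).
      by rewrite ler_wpM2l// ler_ln ?posrE// !mulr_gt0.
    by rewrite /K'; lra.
  have -> : ln (A0 * om x / r) = ln A0 + ln (om x) - ln r.
    by rewrite lnM ?posrE ?mulr_gt0 ?invr_gt0// lnM ?posrE// lnV ?posrE.
  have d1 := dlog _ lnA0.
  have d2 : d * ln (om x) <= Ci + Ci * (1 + ln (2 * A0)).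
    have lnom : ln (om x) <= (1 + ln (2 * A0)) * ln (om y).
      have : ln (om x) <= ln (2 * A0) + ln (om y).
        rewrite -lnM ?posrE ?mulr_gt0// ler_ln ?posrE ?mulr_gt0//.
        apply: (le_trans omxy).
        have : A0 * (r + om y) <= A0 * (om y + om y).
          by rewrite ler_pM2l// lerD2r ltW.
        lra.
      have : ln (2 * A0) * 1 <= ln (2 * A0) * ln (om y) by rewrite ler_wpM2l.
      lra.
    have dx : `|p x - pinf| * ln (om x) <= Ci by rewrite -ler_pdivlMr ?hinf//; lra.
    have dy : `|p y - pinf| * ln (om x) <= Ci * (1 + ln (2 * A0)).
      apply: (@le_trans _ _ (Ci / ln (om y) * ((1 + ln (2 * A0)) * ln (om y)))).
        by apply: ler_pM => //; lra.
      by rewrite mulrACA [X in _ * X]mulrC divff ?mulr1// gt_eqF//; lra.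
    have : d <= `|p x - pinf| + `|p y - pinf|.
      by rewrite [`|p y - _|]distrC -[d]/(`|_|) (le_trans _ (ler_normD _ _))// subrKA.
    move=> dd; apply: (@le_trans _ _ ((`|p x - pinf| + `|p y - pinf|) * ln (om x))).
      by rewrite ler_wpM2r//; lra.
    by rewrite mulrDl lerD.
  have d3 : d * - ln r <= D + `|C0|.
    (* For [r] at least 1/2, [- ln r] is at most 1. For smaller [r], [dist x y < r] brings [LH0]
       into play. *)
    have [r12|r12] := leP (1 / 2) r.
      have lnr : - ln r <= 1.
        rewrite -lnV ?posrE// -[leRHS]expRK ler_ln ?posrE ?invr_gt0 ?expR_gt0//.
        have : r^-1 <= 2 by rewrite -[leRHS]invrK lef_pV2 ?posrE//; lra.
        by have := expR_ge1Dx (1 : R); lra.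
      have : d * - ln r <= d * 1 by rewrite ler_wpM2l.
      lra.
    have [eqxy|xny] := pselect (x = y).
      by rewrite /d eqxy subrr normr0 mul0r addr_ge0.
    have dist0 := dist_gt0 hX xny.
    have lnd : ln (dist x y) < ln r by rewrite ltr_ln ?posrE.
    have lnr : ln r < 0 by rewrite ln_lt0//; lra.
    have := hp x y xny (lt_trans xy r12).
    have -> : - C0 / ln (dist x y) = C0 / - ln (dist x y).
      by rewrite mulNr invrN mulrN.
    rewrite ler_pdivlMr -/d; last lra.
    have : d * - ln r <= d * - ln (dist x y) by rewrite ler_wpM2l//; lra.
    have := ler_norm C0; lra.
  by rewrite /K' !mulrDr; lra.
have [n /andP[n1 n2]] := ex_exp2_between u1.
have : m x0 1 <= K ^+ n.+1 * m x r.
  apply: le_trans (iterK _ _ _ r0); apply: (ball_measure_sub hX) => z.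
  rewrite /qball/= => x0z; apply: (le_lt_trans (tri _ _ x0)).
  apply: (@lt_le_trans _ _ (A0 * om x)).
    rewrite ltr_pM2l// addrC ltrD2r (dist_sym hX) (lt_trans x0z)//.
    exact: expR1_gt1.
  by rewrite -ler_pdivrMr// (le_trans _ n2)// le_max lexx orbT.
move=> mm; have : ln (m x0 1) <= n.+1%:R * ln K + ln (m x r).
  rewrite mulr_natl -lnXn// -lnM ?posrE ?exprn_gt0//.
  by rewrite ler_ln ?posrE ?mulr_gt0 ?exprn_gt0.
move=> lnm; have nu : n%:R * ln 2 <= ln u.
  by rewrite mulr_natl -lnXn ?ler_ln ?posrE ?exprn_gt0 ?ltW//; lra.
have : - ln (m x r) <= ln K / ln 2 * ln u + (ln K + `|ln (m x0 1)|).
  have : n%:R * ln K <= ln K / ln 2 * ln u.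
    by rewrite mulrC -mulrA ler_wpM2l// mulrC ler_pdivlMr.
  have := ler_norm (- ln (m x0 1)); rewrite normrN.
  move: lnm; rewrite -natr1 mulrDl mul1r; lra.
move=> h; apply: (le_trans (ler_wpM2l d0 h)).
rewrite mulrDr lerD//; last by rewrite ler_wpM2r// addr_ge0.
by rewrite mulrCA ler_wpM2l// divr_ge0// ltW.
Qed.

End log_hoelder.

Lemma measurable_powR_fun (d : measure_display) (T : measurableType d)
    (R : realType) (f e : T -> R) :
  measurable_fun setT f -> measurable_fun setT e -> (forall x, 0 <= f x) ->
  (forall x, 0 < e x) -> measurable_fun setT (fun x => f x `^ e x).
Proof.
move=> mf me f0 e0.
rewrite (_ : (fun _ => _) =
  (fun x => expR (e x * ln (f x))) \* \1_[set x | 0 < f x]); last first.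
  apply/funext => x /=; rewrite indicE.
  have := f0 x; rewrite le0r => /predU1P[fx|fx].
    rewrite fx powR0 ?gt_eqF// memNset ?mulr0//= fx; exact/negP/negbT/ltxx.
  by rewrite mem_set// mulr1 powR_expR.
apply: measurable_funM.
  apply: measurableT_comp => //; apply: measurable_funM => //.
  exact: measurableT_comp.
by apply: measurable_indic; exact: measurable_lt_set.
Qed.

Lemma ler_npowR (R : realType) (t v e : R) : 0 < t -> t <= v -> e <= 0 ->
  v `^ e <= t `^ e.
Proof.
move=> t0 tv e0; have v0 : 0 < v by lra.
rewrite -(opprK e) (powRN v) (powRN t) lef_pV2 ?posrE ?powR_gt0//.
by rewrite ge0_ler_powR ?nnegrE ?(ltW t0) ?(ltW v0)//; lra.
Qed.

(** A substitute for Jensen's inequality: for [v > t], write [v = v^(1-s) * v^s] and use that the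
    first power decreases. The level [t] stays free, to be matched with the average of [v^s]. *)
Lemma powR_chord (R : realType) (v t s : R) : 0 <= v -> 0 < t -> 1 <= s ->
  v <= t + t `^ (1 - s) * v `^ s.
Proof.
move=> v0 t0 s1; have [vt|tv] := leP v t.
  by rewrite -[leLHS]addr0 lerD ?mulr_ge0 ?powR_ge0.
have {}v0 : 0 < v by lra.
rewrite -[leLHS]add0r lerD ?(ltW t0)//.
have {1}-> : v = v `^ (1 - s) * v `^ s.
  by rewrite -powRD ?(gt_eqF v0) ?implybT// subrK powRr1// ltW.
by rewrite ler_wpM2r ?powR_ge0// ler_npowR ?(ltW tv)//; lra.
Qed.

(** * Averages over balls *)

Section averages.
Context (R : realType) (disp : measure_display) (X : measurableType disp).
Context (dist : X -> X -> R) (mu : {measure set X -> \bar R}).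
Context (hX : homogeneous_space dist mu).
Local Notation B := (qball dist).
Local Notation m := (ball_measure dist mu).

Let mB x r : measurable (B x r). Proof. exact: (measurable_qball hX). Qed.
Hint Resolve mB : core.

Lemma integral_affine_le (f G : X -> R) (a b c : R) x r :
  measurable_fun setT f -> measurable_fun setT G ->
  (forall y, 0 <= f y) -> (forall y, 0 <= G y) -> 0 <= a -> 0 <= b ->
  (forall y, B x r y -> f y <= a + b * G y) ->
  (\int[mu]_(y in B x r) (G y)%:E <= c%:E)%E ->
  (\int[mu]_(y in B x r) (f y)%:E <= (a * m x r + b * c)%:E)%E.
Proof.
move=> mf mG f0 G0 a0 b0 fG Gc.
have mbG : measurable_fun (B x r) (fun y => b * G y).
  by apply: measurable_funTS; exact: measurable_funM.
apply: (@le_trans _ _ (\int[mu]_(y in B x r) (a + b * G y)%:E)%E).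
  apply: ge0_le_integral_EFin => //; first exact: measurable_funTS.
  exact: measurable_funD.
under eq_integral do rewrite EFinD.
rewrite ge0_integralD//; last 2 first.
- by move=> y _; rewrite lee_fin mulr_ge0.
- exact/measurable_EFinP.
rewrite EFinD leeD//.
  by rewrite integral_cst// (ball_measureE hX) -EFinM.
rewrite ge0_integralZ_EFin//; last exact: measurable_funTS.
by rewrite EFinM lee_wpmul2l// lee_fin.
Qed.

(** Hoelder's inequality on a ball, up to the constant: the level [t = m^(-1/s)] in [powR_chord]
    gives both terms the order [m^(1 - 1/s)]. *)
Lemma integral_qball_le_powR (G : X -> R) (s A : R) : 1 <= s ->
  measurable_fun setT G -> (forall y, 0 <= G y) ->
  (\int[mu]_y (G y `^ s)%:E <= A%:E)%E ->
  forall x r, 0 < r ->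
  (\int[mu]_(y in B x r) (G y)%:E <= ((1 + A) * m x r `^ (1 - s^-1))%:E)%E.
Proof.
move=> s1 mG G0 GA x r r0; have s0 : 0 < s by lra.
have m0 : 0 < m x r by exact: (ball_measure_gt0 hX).
have mGs : measurable_fun setT (fun y => G y `^ s).
  exact: (measurableT_comp (measurable_powR _)).
pose t := m x r `^ (- s^-1); have t0 : 0 < t by rewrite powR_gt0.
have GsA : (\int[mu]_(y in B x r) (G y `^ s)%:E <= A%:E)%E.
  apply: le_trans GA; apply: ge0_subset_integral => //.
    exact/measurable_EFinP.
  by move=> y _; rewrite lee_fin powR_ge0.
have := @integral_affine_le G _ t (t `^ (1 - s)) _ x r mG mGs G0
  (fun y => powR_ge0 _ _) (ltW t0) (powR_ge0 _ _)
  (fun y _ => powR_chord (G0 y) t0 s1) GsA.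
move/le_trans; apply; rewrite lee_fin mulrDl mul1r lerD//.
  by rewrite mulrC /t -{1}(powRr1 (ltW m0)) -powRD// (gt_eqF m0) implybT.
rewrite mulrC ler_wpM2l//; last first.
  rewrite /t -powRrM; have -> // : - s^-1 * (1 - s) = 1 - s^-1.
  by field; rewrite gt_eqF.
by rewrite -lee_fin; apply: le_trans GA; apply: integral_ge0 => y _; rewrite lee_fin powR_ge0.
Qed.

(** Apply [powR_chord] at each [y] with exponent [p y / s] and the common level [T = t^(1/p x)]. The
    coefficient [T^(1 - p y / s)] differs from its value at [x] by [T^((p x - p y) / s)], which the
    oscillation bound controls. *)
Lemma integral_qball_large_le (p f : X -> R) (s pM L : R) :
  1 < s -> (forall x, s <= p x <= pM) -> 0 <= L ->
  (forall x y r, 0 < r -> dist x y < r ->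
    `|p x - p y| * (- ln (m x r)) <= L) ->
  measurable_fun setT p -> measurable_fun setT f ->
  (forall y, f y = 0 \/ 1 < f y) ->
  forall x r t, 0 < r -> 0 < t -> t <= 2 `^ s / m x r ->
  (\int[mu]_(y in B x r) (f y `^ (p y / s))%:E <= (t `^ s^-1 * m x r)%:E)%E ->
  (\int[mu]_(y in B x r) (f y)%:E <=
    ((1 + expR (pM * (s * ln 2) + L)) * t `^ (p x)^-1 * m x r)%:E)%E.
Proof.
move=> s1 hp L0 osc mp mf f01 x r t r0 t0 tm int.
have s0 : 0 < s by lra.
have m0 : 0 < m x r by exact: (ball_measure_gt0 hX).
have f0 y : 0 <= f y by case: (f01 y) => [->|]; lra.
have ps y : 1 <= p y / s by rewrite ler_pdivlMr// mul1r; case/andP: (hp y).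
have px0 : 0 < p x by case/andP: (hp x); lra.
have ipx : (p x)^-1 <= s^-1.
  by rewrite lef_pV2 ?posrE//; case/andP: (hp x).
have mG : measurable_fun setT (fun y => f y `^ (p y / s)).
  apply: measurable_powR_fun => //; first exact: measurable_funM.
  by move=> y; have := ps y; lra.
have e0 := expR_ge0 (pM * (s * ln 2) + L).
(* Here the gap in the values of [f] matters: it gives [f <= f^(p/s)], and [t < 1] gives
   [t^(1/s) <= t^(1/p x)]. *)
have [t1|t1] := ltP t 1.
  apply: (@le_trans _ _ (t `^ s^-1 * m x r)%:E).
    apply: le_trans int; apply: ge0_le_integral_EFin => //.
    - exact: measurable_funTS.
    - exact: measurable_funTS.
    move=> y _; case: (f01 y) => [->|fy]; first exact: powR_ge0.
    rewrite -[leLHS]powRr1; last lra.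
    by apply: ler_powR => //; lra.
  rewrite lee_fin ler_pM2r//.
  apply: (@le_trans _ _ (t `^ (p x)^-1)).
    rewrite !powR_expR// ler_expR ler_wnM2r// ln_le0//; lra.
  by rewrite ler_peMl ?powR_ge0//; lra.
pose T := t `^ (p x)^-1.
have T1 : 1 <= T.
  by rewrite /T powR_expR// -[leLHS]expR0 ler_expR mulr_ge0 ?ln_ge0//
    invr_ge0 ltW.
have T0 : 0 < T by lra.
pose K := expR (pM * (s * ln 2) + L).
pose b := K * (T * t `^ (- s^-1)).
have key y : B x r y -> T `^ (1 - p y / s) <= b.
  move=> xy.
  have -> : 1 - p y / s = (p x - p y) / s + (1 - p x / s) by ring.
  rewrite powRD; last by rewrite (gt_eqF T0) implybT.
  have -> : T `^ (1 - p x / s) = T * t `^ (- s^-1).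
    rewrite powRD ?powRr1 ?(ltW T0)//; last by rewrite (gt_eqF T0) implybT.
    congr (_ * _); rewrite /T -powRrM; congr (_ `^ _).
    by field; rewrite !gt_eqF.
  rewrite ler_wpM2r ?mulr_ge0 ?powR_ge0 ?(ltW T0)//.
  rewrite powR_expR// ler_expR.
  have lnT : 0 <= ln T by rewrite ln_ge0.
  (* The upper bound on [t] brings in [- ln (m x r)], the quantity that the oscillation bound pairs
     with [|p x - p y|]. *)
  have lnt : ln t <= s * ln 2 - ln (m x r).
    have -> : s * ln 2 - ln (m x r) = ln (2 `^ s / m x r).
      rewrite lnM ?posrE ?powR_gt0 ?invr_gt0// lnV ?posrE// powR_expR// expRK.
      by [].
    by rewrite ler_ln ?posrE// divr_gt0 ?powR_gt0.
  have lnTt : ln T <= ln t.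
    rewrite /T powR_expR// expRK -[leRHS]mul1r ler_wpM2r ?ln_ge0//.
    by rewrite invf_le1//; case/andP: (hp x); lra.
  have oxy := osc x y r r0 xy.
  set d := `|p x - p y| in oxy.
  have dpM : d <= pM.
    have := hp x; have := hp y; rewrite /d; move=> /andP[? ?] /andP[? ?].
    by rewrite ler_norml; lra.
  have d0 : 0 <= d by exact: normr_ge0.
  apply: (@le_trans _ _ (d * ln T)).
    rewrite ler_wpM2r//; apply: (@le_trans _ _ (d / s)).
      by rewrite ler_wpM2r ?invr_ge0 ?(ltW s0)// ler_norm.
    by rewrite ler_pdivrMr// ler_peMr//; lra.
  have : d * ln T <= d * (s * ln 2 - ln (m x r)).
    by rewrite ler_wpM2l//; lra.
  have : d * (s * ln 2) <= pM * (s * ln 2).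
    by rewrite ler_wpM2r// mulr_ge0 ?(ltW s0)// ln_ge0//; lra.
  move=> h1; rewrite mulrDr => h2; lra.
have b0 : 0 <= b by rewrite !mulr_ge0 ?powR_ge0 ?expR_ge0// ltW.
have := @integral_affine_le f _ T b _ x r mf mG f0
  (fun y => powR_ge0 _ _) (ltW T0) b0 _ int.
have aff y : B x r y -> f y <= T + b * f y `^ (p y / s).
  move=> xy; apply: (le_trans (powR_chord (f0 y) T0 (ps y))).
  by rewrite lerD2l ler_wpM2r ?powR_ge0// key.
move=> /(_ aff)/le_trans; apply; rewrite lee_fin.
have tt : t `^ (- s^-1) * t `^ s^-1 = 1.
  by rewrite powRN mulVf// gt_eqF// powR_gt0.
rewrite /b -/K -/T mulrDl mul1r mulrDl lerD2l.
rewrite [leLHS](_ : _ = K * T * m x r * (t `^ (- s^-1) * t `^ s^-1)); last by ring.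
by rewrite tt mulr1.
Qed.

End averages.

(** * Modular estimates *)

Section majorant.
Context (R : realType) (disp : measure_display) (X : measurableType disp).
Context (dist : X -> X -> R) (mu : {measure set X -> \bar R}).
Context (hR : reverse_doubling_space dist mu).
Context (x0 : X) (eta s pM : R) (p : X -> R).
Context (heta : 0 < eta < 1) (s1 : 1 < s) (pMeta : pM < eta^-1).
Context (hp : forall x, s <= p x <= pM) (mp : measurable_fun setT p).
Context (hLH0 : LH0 dist p).
Local Notation B := (qball dist).
Local Notation m := (ball_measure dist mu).
Local Notation om x := (expR 1 + dist x x0).
Local Notation kernel x y := ((m x (dist x y) `^ (1 - eta))^-1).
Let hX := rds_homogeneous hR.
Let th := pM^-1 - eta.

Let mB x r : measurable (B x r). Proof. exact: (measurable_qball hX). Qed.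
Hint Resolve mB : core.

Let s0 : 0 < s. Proof. exact: lt_trans s1. Qed.

Let p0 x : 0 < p x. Proof. by have /andP[? _] := hp x; exact: lt_le_trans s0 _. Qed.

Let pM0 : 0 < pM. Proof. by have /andP[_] := hp x0; exact: lt_le_trans. Qed.

Let th0 : 0 < th.
Proof.
have /andP[e0 _] := heta.
by rewrite subr_gt0 -[ltLHS]invrK ltf_pV2 ?posrE ?invr_gt0.
Qed.

Let th_le x : th <= (p x)^-1 - eta.
Proof. by rewrite lerD2r lef_pV2 ?posrE//; case/andP: (hp x). Qed.

Lemma measurable_kernel x : measurable_fun setT (fun y => kernel x y).
Proof.
rewrite (_ : (fun _ => _) = (fun y => m x (dist x y) `^ - (1 - eta))).
  apply: (measurableT_comp (measurable_powR _)).
  exact: (measurable_ball_measure_dist hX).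
by apply/funext => y; rewrite powRN.
Qed.

Lemma frac_integral_large_le (L : R) : 0 <= L ->
  (forall x y r, 0 < r -> dist x y < r ->
    `|p x - p y| * (- ln (m x r)) <= L) ->
  exists2 A : R, 0 < A & forall f : X -> R, measurable_fun setT f ->
    (forall y, f y = 0 \/ 1 < f y) ->
    (\int[mu]_y (f y `^ p y)%:E <= 1)%E ->
    exists W : X -> \bar R, [/\ measurable_fun setT W, (forall x, 0 <= W x)%E,
      (\int[mu]_x W x <= A%:E)%E &
      forall x w, 0 < w -> (W x <= w%:E)%E ->
        (\int[mu]_y (f y * kernel x y)%:E <= (A * w `^ ((p x)^-1 - eta))%:E)%E].
Proof.
move=> L0 osc; have sgt1 := s1.
have [CH CH0 hedberg] := frac_integral_le hR heta th0.
have [Cs Cs0 maximal] := maximal_majorant hX s1.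
pose K := 1 + expR (pM * (s * ln 2) + L).
have K0 : 0 < K by rewrite addr_gt0// expR_gt0.
have K20 : 0 < K * 2 by rewrite mulr_gt0.
exists (Cs + CH * (K * 2)) => [|f mf f01 fp]; first by rewrite addr_gt0// mulr_gt0.
have f0 y : 0 <= f y by case: (f01 y) => [->|]; lra.
have ps0 y : 0 < p y / s by rewrite divr_gt0.
pose G y := f y `^ (p y / s).
have mG : measurable_fun setT G.
  by apply: measurable_powR_fun => //; exact: measurable_funM.
have G0 y : 0 <= G y by exact: powR_ge0.
have Gs : (\int[mu]_y (G y `^ s)%:E <= 1)%E.
  under eq_integral do rewrite /G -powRrM divfK ?(gt_eqF s0)//.
  exact: fp.
have [W [mW W0 intW maxW]] := maximal G mG G0.
exists W; split => //.
  apply: (le_trans intW); rewrite EFinD -[leLHS]adde0 leeD//; last first.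
    by rewrite lee_fin mulr_ge0// ltW.
  by rewrite -[leRHS]mule1 lee_pmul2l.
move=> x w w0 Ww.
have split_pow r a : 0 < r -> (2 `^ s / m x r) `^ a = 2 `^ (s * a) * m x r `^ (- a).
  move=> r0; have m0 : 0 < m x r by exact: (ball_measure_gt0 hX).
  rewrite powRM ?powR_ge0 ?invr_ge0 ?(ltW m0)// -powRrM; congr (_ * _).
  by rewrite -powR_inv1 ?(ltW m0)// -powRrM mulN1r.
have mm r a : 0 < r -> m x r `^ (- a) * m x r = m x r `^ (1 - a).
  move=> r0; have m0 : 0 < m x r by exact: (ball_measure_gt0 hX).
  by rewrite addrC -[X in _ * X]powRr1 ?(ltW m0)// -powRD// (gt_eqF m0) implybT.
(* Since [G^s] has integral at most 1, the average of [G] is at most [2 * m^(-1/s)]: this is where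
   the cap [2^s / m] on the levels comes from. *)
have intG2 r : 0 < r ->
    (\int[mu]_(y in B x r) (G y)%:E <= ((2 `^ s / m x r) `^ s^-1 * m x r)%:E)%E.
  move=> r0; rewrite split_pow// divff ?gt_eqF// powRr1// -mulrA mm//.
  exact: (integral_qball_le_powR hX (ltW s1) mG G0 Gs).
have ts0 r : 0 < r -> 0 < 2 `^ s / m x r.
  by move=> r0; rewrite divr_gt0 ?powR_gt0//; exact: (ball_measure_gt0 hX).
have large := integral_qball_large_le hX s1 hp L0 osc mp mf f01.
apply: (@le_trans _ _ (CH * (K * 2) * w `^ ((p x)^-1 - eta))%:E); last first.
  by rewrite lee_fin ler_wpM2r ?powR_ge0// lerDr ltW.
apply: hedberg => //; first by have /andP[? _] := hp x; lra.
- by rewrite ltW.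
- move=> r r0.
  have m0 : 0 <= m x r by exact: (ball_measure_ge0 hX).
  (* Both bounds on the average of [G] hold, so the smaller one may be used; it respects the cap
     even if [w] is large. *)
  pose t := Num.min w (2 `^ s / m x r).
  have t0 : 0 < t by rewrite lt_min w0 ts0.
  have tm : t <= 2 `^ s / m x r by rewrite ge_min lexx orbT.
  have intt : (\int[mu]_(y in B x r) (G y)%:E <= (t `^ s^-1 * m x r)%:E)%E.
    rewrite /t; have [_|_] := leP w (2 `^ s / m x r); last exact: intG2.
    exact: maxW.
  apply: (le_trans (large x r t r0 t0 tm intt)).
  rewrite lee_fin -/K ler_wpM2r// ler_pM ?powR_ge0 ?(ltW K0)//; first lra.
  rewrite ge0_ler_powR ?nnegrE ?invr_ge0 ?(ltW t0) ?(ltW w0) ?(ltW (p0 _))//.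
  by rewrite ge_min lexx.
- move=> r r0.
  apply: (le_trans (large x r _ r0 (ts0 _ r0) (lexx _) (intG2 _ r0))).
  rewrite lee_fin -/K split_pow// -!mulrA ler_pM2l// mm//.
  rewrite ler_wpM2r ?powR_ge0// -[leRHS]powRr1//; apply: ler_powR; first lra.
  by rewrite ler_pdivrMr// mul1r; have /andP[] := hp x.
Qed.

Lemma frac_integral_small_le (pinf Ci : R) : s <= pinf <= pM -> 0 <= Ci ->
  (forall x, `|p x - pinf| <= Ci / ln (om x)) ->
  exists2 A : R, 0 < A & forall f : X -> R, measurable_fun setT f ->
    (forall y, 0 <= f y <= 1) ->
    (\int[mu]_y (f y `^ p y)%:E <= 1)%E ->
    exists W : X -> \bar R, [/\ measurable_fun setT W, (forall x, 0 < W x)%E,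
      (\int[mu]_x W x <= A%:E)%E &
      forall x w, 0 < w -> (W x <= w%:E)%E ->
        (\int[mu]_y (f y * kernel x y)%:E <= (A * w `^ ((p x)^-1 - eta))%:E)%E].
Proof.
move=> /andP[spinf pinfM] Ci0 hinf; have sgt1 := s1.
have e1 : 1 < pinf by lra.
have pinf0 : 0 < pinf by lra.
have omge x : expR 1 <= om x by rewrite lerDl (dist_ge0 hX).
have omgt0 x : 0 < om x by rewrite (lt_le_trans _ (omge x))// expR_gt0.
have [CH CH0 hedberg] := frac_integral_le hR heta th0.
have [Cp Cp0 maximal] := maximal_majorant hX e1.
have [M M0 [Kw Kw0 intw]] := weight_integrable hX x0.
pose wt x : R := om x `^ (- M).
have wt0 x : 0 < wt x by rewrite powR_gt0.
have mwt : measurable_fun setT wt by exact: (measurable_weight hX).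
(* [K3] is the cost of exchanging [p] for [pinf], and [K4] that of exchanging the conjugate
   exponents [q]. Those are inverses of quantities at least [th], whence the decay constant [K5]
   with [th ^+ 2]. *)
pose K3 := expR (M / 1 * Ci); pose K5 := Ci / th ^+ 2.
pose K4 := expR (M / 1 * K5).
have K30 : 0 < K3 by exact: expR_gt0.
have K50 : 0 <= K5 by rewrite divr_ge0// exprn_ge0// ltW.
have K41 : 1 <= K4.
  by rewrite /K4 -[leLHS]expR0 ler_expR divr1 mulr_ge0// ltW.
have K40 : 0 < K4 by lra.
pose A2 := K3 + Kw; have A20 : 0 < A2 by rewrite addr_gt0.
pose A := CH * (1 + A2) * 2; have A0 : 0 < A by rewrite !mulr_gt0// addr_gt0.
exists (K4 * (Cp * A2) + Kw + A) => [|f mf f01 fp].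
  by rewrite !addr_gt0// !mulr_gt0.
have f0 y : 0 <= f y by case/andP: (f01 y).
have mfp : measurable_fun setT (fun y => f y `^ p y).
  exact: measurable_powR_fun.
have fpinf : (\int[mu]_y (f y `^ pinf)%:E <= A2%:E)%E.
  apply: (@le_trans _ _ (\int[mu]_y (K3 * f y `^ p y + wt y)%:E)%E).
    apply: ge0_le_integralT => y; first by rewrite lee_fin powR_ge0.
    rewrite lee_fin; apply: powR_exponent_swap => //; first lra.
      by have /andP[? _] := hp y; lra.
    by rewrite distrC.
  have K3fp y : 0 <= K3 * f y `^ p y by rewrite mulr_ge0 ?powR_ge0// ltW.
  have wt_ge0 y : 0 <= wt y by exact: ltW.
  rewrite ge0_integralD_EFin//; last exact: measurable_funM.
  rewrite EFinD leeD// ge0_integralZ_EFin ?(ltW K30)//; last first.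
    by move=> y; exact: powR_ge0.
  by rewrite -[leRHS]mule1 lee_pmul2l.
have [W [mW W0 intW maxW]] := maximal f mf f0.
have KW0 x : (0 <= K4%:E * W x)%E by rewrite mule_ge0// lee_fin ltW.
have mKW : measurable_fun setT (fun x => K4%:E * W x)%E by exact: emeasurable_funM.
have wtE0 x : (0 <= (wt x)%:E)%E by rewrite lee_fin ltW.
have mwtE : measurable_fun setT (EFin \o wt) by exact/measurable_EFinP.
(* The weight absorbs the error of the second exchange. It also makes the majorant positive, so that
   its finite values can serve as [w]. *)
exists (fun x => K4%:E * W x + (wt x)%:E)%E; split.
- exact: emeasurable_funD.
- by move=> x; rewrite (@lt_le_trans _ _ (wt x)%:E) ?lte_fin// leeDr.
- rewrite ge0_integralD// ge0_integralZl_EFin//; last exact: ltW.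
  rewrite EFinD -[leLHS]adde0 leeD//; last by rewrite lee_fin ltW.
  rewrite EFinD leeD// EFinM lee_pmul2l//.
  by apply: (le_trans intW); rewrite EFinM lee_pmul2l.
move=> x w w0 Ww.
have wtw : wt x <= w.
  by rewrite -lee_fin (le_trans _ Ww)// leeDr// mule_ge0// lee_fin ltW.
have K4W : (K4%:E * W x <= w%:E)%E.
  by rewrite (le_trans _ Ww)// leeDl// lee_fin ltW.
(* Averages of [f <= 1] are at most 1, so the maximal bound can be capped at 1; the exchange of
   exponents needs a base in [0, 1]. *)
pose v := Num.min (w / K4) 1.
have v0 : 0 < v by rewrite lt_min divr_gt0//=.
have v1 : v <= 1 by rewrite ge_min lexx orbT.
have vw : K4 * v <= w.
  by rewrite mulrC -ler_pdivlMr// ge_min lexx.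
have ball1 r : 0 < r -> (\int[mu]_(y in B x r) (f y)%:E <= (v `^ pinf^-1 * m x r)%:E)%E.
  move=> r0; rewrite /v; have [_|_] := leP (w / K4) 1.
    apply: maxW => //; first by rewrite divr_gt0.
    rewrite -(@lee_pmul2l _ K4%:E)//.
    by rewrite -EFinM mulrC divfK ?gt_eqF.
  rewrite (_ : 1 `^ pinf^-1 = 1); last by rewrite powR1.
  have := @integral_affine_le _ _ _ dist mu hX f (cst 0) 1 0 0 x r mf
    (measurable_cst _) f0 (fun=> lexx 0) ler01 (lexx 0).
  move=> h; apply: (le_trans (h _ _)).
  - by move=> y _ /=; rewrite mulr0 addr0; case/andP: (f01 y).
  - by rewrite integral0.
  - by rewrite lee_fin mul0r addr0.
have k0 : th <= pinf^-1 - eta by rewrite lerD2r lef_pV2.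
have k1 : 0 < pinf^-1 - eta by exact: lt_le_trans th0 k0.
set k := pinf^-1 - eta in k0 k1.
pose qx := ((p x)^-1 - eta)^-1.
have iq0 : 0 < (p x)^-1 - eta by exact: lt_le_trans th0 (th_le x).
have /andP[eta0 eta1] := heta.
have iple1 (P : R) : 1 < P -> P^-1 <= 1.
  by move=> P1; rewrite invf_le1 ?(ltW P1)//; exact: lt_trans P1.
have px1 : 1 < p x by have /andP[+ _] := hp x; exact: lt_le_trans.
have q1 : 1 <= qx by rewrite /qx invf_ge1//; have := iple1 _ px1; lra.
have qinf1 : 1 <= k^-1 by rewrite invf_ge1// /k; have := iple1 _ e1; lra.
have qdiff : `|qx - k^-1| <= K5 / ln (om x).
  have lnom : 0 < ln (om x) by have := ln_ge1 (omge x); lra.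
  have -> : qx - k^-1 = (p x - pinf) / (p x * pinf) / (((p x)^-1 - eta) * k).
    have -> : (p x - pinf) / (p x * pinf) = k - ((p x)^-1 - eta).
      by rewrite /k; field; rewrite !gt_eqF.
    rewrite /qx; move: ((p x)^-1 - eta) iq0 => a a0.
    by field; rewrite !gt_eqF.
  have den : th ^+ 2 <= ((p x)^-1 - eta) * k.
    by rewrite expr2 ler_pM ?(ltW th0).
  have th20 : 0 < th ^+ 2 by rewrite exprn_gt0.
  have pp : 1 <= p x * pinf by rewrite -[leLHS]mulr1 ler_pM// ltW.
  have iq_k : 0 < ((p x)^-1 - eta) * k by rewrite mulr_gt0.
  have pp0 : 0 < p x * pinf by rewrite mulr_gt0.
  rewrite !normrM !normfV (gtr0_norm iq_k) (gtr0_norm pp0) /K5 [leRHS]mulrAC.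
  rewrite ler_pM ?mulr_ge0 ?invr_ge0 ?(ltW iq_k) ?(ltW pp0)//; last first.
    by rewrite lef_pV2 ?posrE.
  apply: le_trans (hinf x); rewrite ler_pdivrMr// ler_peMr//.
have vk01 : 0 <= v `^ k <= 1.
  rewrite powR_ge0/= -(congr1 (@^~ k) (powR1 R)).
  by rewrite ge0_ler_powR ?nnegrE ?(ltW k1) ?(ltW v0).
(* With base [v^k] and exponents [qx] and [k^-1], this reads [(v^k)^qx <= K4 * v + wt x], which is
   at most [2 * w]. *)
have := powR_exponent_swap vk01 ltr01 q1 qinf1 (omge x) K50 M0 qdiff.
rewrite -/K4 -/(wt x) -(powRrM v k k^-1) divff ?gt_eqF// powRr1 ?(ltW v0)// => swap.
have hw : v `^ k <= 2 * w `^ ((p x)^-1 - eta).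
  have -> : v `^ k = ((v `^ k) `^ qx) `^ ((p x)^-1 - eta).
    by rewrite -(powRrM (v `^ k)) /qx mulVf ?gt_eqF// powRr1// powR_ge0.
  apply: (@le_trans _ _ ((2 * w) `^ ((p x)^-1 - eta))).
    have w20 : 0 <= 2 * w by rewrite mulr_ge0// ltW.
    rewrite ge0_ler_powR ?nnegrE ?powR_ge0 ?(ltW iq0)//.
    by rewrite mulr_natl mulr2n (le_trans swap)// lerD.
  rewrite powRM ?(ltW w0)// ler_wpM2r ?powR_ge0// -[leRHS]powRr1//.
  apply: ler_powR; first by rewrite ler1n.
  by rewrite lerBlDr (le_trans (iple1 _ px1))// lerDl ltW.
apply: (@le_trans _ _ (CH * (1 + A2) * v `^ k)%:E).
  apply: hedberg => //.
  - exact: ltW.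
  - by rewrite addr_ge0// ltW.
  - move=> r r0; apply: (le_trans (ball1 r r0)); rewrite lee_fin -mulrA.
    by rewrite ler_peMl ?lerDl ?(ltW A20)// mulr_ge0 ?powR_ge0 ?(ball_measure_ge0 hX).
  - exact: (integral_qball_le_powR hX (ltW e1) mf f0 fpinf).
rewrite lee_fin; apply: (@le_trans _ _ (A * w `^ ((p x)^-1 - eta))).
  by rewrite /A -[leRHS]mulrA ler_pM2l// mulr_gt0// addr_gt0.
by rewrite ler_wpM2r ?powR_ge0// lerDr addr_ge0 ?mulr_ge0// ltW.
Qed.

End majorant.

(** * Combination of the two parts *)

Section bounded.
Context (R : realType) (disp : measure_display) (X : measurableType disp).
Context (dist : X -> X -> R) (mu : {measure set X -> \bar R}).
Context (hR : reverse_doubling_space dist mu).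
Context (x0 : X) (eta s pM : R) (p : X -> R).
Context (heta : 0 < eta < 1) (s1 : 1 < s) (pMeta : pM < eta^-1).
Context (hp : forall x, s <= p x <= pM) (mp : measurable_fun setT p).
Context (hLH : LH dist x0 p).
Local Notation B := (qball dist).
Local Notation m := (ball_measure dist mu).
Local Notation om x := (expR 1 + dist x x0).
Local Notation kernel x y := ((m x (dist x y) `^ (1 - eta))^-1).
Let hX := rds_homogeneous hR.

Let p0 x : 0 < p x.
Proof.
by have /andP[? _] := hp x; apply: lt_le_trans _ (lt_trans ltr01 s1) _.
Qed.

Lemma frac_integral_majorant :
  exists2 A : R, 0 < A & forall g : X -> R, measurable_fun setT g ->
    (forall y, 0 <= g y) ->
    (\int[mu]_y (g y `^ p y)%:E <= 1)%E ->
    exists W : X -> \bar R, [/\ measurable_fun setT W, (forall x, 0 < W x)%E,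
      (\int[mu]_x W x <= A%:E)%E &
      forall x w, 0 < w -> (W x <= w%:E)%E ->
        (\int[mu]_y (g y * kernel x y)%:E <= (A * w `^ ((p x)^-1 - eta))%:E)%E].
Proof.
have [hLH0 [Cinf [rinf hinf]]] := hLH.
have sM : s <= pM by have /andP[/le_trans + /[dup] h] := hp x0; apply.
have om1 x : 1 <= ln (om x) by apply: ln_ge1; rewrite lerDl (dist_ge0 hX).
(* [rinf] may lie outside [[s, pM]], for instance on a bounded space. Projecting it onto this
   interval does not increase its distance to any [p x]. *)
pose pinf := Num.max s (Num.min pM rinf).
have pinfP : s <= pinf <= pM by rewrite le_max lexx/= ge_max sM ge_min lexx.
have hpinf x : `|p x - pinf| <= `|Cinf| / ln (om x).
  apply: (@le_trans _ _ `|p x - rinf|).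
    have /andP[sp pp] := hp x.
    have : `|p x - rinf| >= p x - rinf := ler_norm _.
    have : `|p x - rinf| >= - (p x - rinf) by rewrite -normrN; exact: ler_norm.
    move: `|p x - rinf| => D h1 h2; rewrite ler_norml /pinf.
    have [h3|h3] := leP pM rinf; have [h4|h4] := leP s _; apply/andP; split; lra.
  apply: (le_trans (hinf x)); rewrite ler_wpM2r ?ler_norm// invr_ge0.
  by have := om1 x; lra.
have pdiff x y : `|p x - p y| <= pM.
  have /andP[? ?] := hp x; have /andP[? ?] := hp y; have := s1.
  by rewrite ler_norml => ?; lra.
have [L L0 osc] := log_oscillation hX hLH0 hpinf (normr_ge0 _) pdiff.
have [A1 A10 large] := frac_integral_large_le hR x0 heta s1 pMeta hp mp L0 osc.
have [A2 A20 small] :=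
  frac_integral_small_le hR heta s1 pMeta hp mp pinfP (normr_ge0 _) hpinf.
exists (A1 + A2) => [|g mg g0 gp]; first exact: addr_gt0.
pose E := [set y | 1 < g y].
have mE : measurable E by exact: measurable_lt_set.
pose f1 y := g y * \1_E y; pose f2 y := g y * \1_(~` E) y.
have mf1 : measurable_fun setT f1.
  by apply: measurable_funM => //; exact: measurable_indic.
have mf2 : measurable_fun setT f2.
  by apply: measurable_funM => //; apply: measurable_indic; exact: measurableC.
have f12 y : f1 y + f2 y = g y.
  rewrite /f1 /f2 -mulrDr !indicE in_setC.
  by case: (y \in E); rewrite /= ?(addr0, add0r) mulr1.
have f10 y : 0 <= f1 y by rewrite mulr_ge0.
have f20 y : 0 <= f2 y by rewrite mulr_ge0.
have pow_le f : (forall y, 0 <= f y) -> (forall y, f y <= g y) ->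
    (\int[mu]_y (f y `^ p y)%:E <= 1)%E.
  move=> f0 fg; apply: le_trans gp; apply: ge0_le_integralT => y.
    by rewrite lee_fin powR_ge0.
  by rewrite lee_fin ge0_ler_powR ?nnegrE// ltW.
have f1P y : f1 y = 0 \/ 1 < f1 y.
  rewrite /f1 indicE; have [/set_mem Ey|_] := boolP (y \in E).
    by right; rewrite mulr1.
  by left; rewrite mulr0.
have f2P y : 0 <= f2 y <= 1.
  rewrite f20/= /f2 indicE; have [/set_mem Ey|_] := boolP (y \in ~` E).
    by rewrite mulr1 leNgt; exact/negP.
  by rewrite mulr0.
have [W1 [mW1 W10 intW1 boundW1]] := large f1 mf1 f1P
  (pow_le f1 f10 (fun y => ltac:(by rewrite -f12 lerDl))).
have [W2 [mW2 W20 intW2 boundW2]] := small f2 mf2 f2P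
  (pow_le f2 f20 (fun y => ltac:(by rewrite -f12 lerDr))).
exists (fun x => W1 x + W2 x)%E; split.
- exact: emeasurable_funD.
- by move=> x; rewrite (lt_le_trans (W20 x))// leeDr.
- rewrite ge0_integralD//; last by move=> x _; exact: ltW.
  by rewrite EFinD leeD.
move=> x w w0 Ww.
have k0 y : 0 <= kernel x y by rewrite invr_ge0 powR_ge0.
under eq_integral do rewrite -f12 mulrDl.
have mk := measurable_kernel hR eta x.
rewrite ge0_integralD_EFin//; last 4 first.
- exact: measurable_funM.
- exact: measurable_funM.
- by move=> y; rewrite mulr_ge0.
- by move=> y; rewrite mulr_ge0.
rewrite mulrDl EFinD leeD//.
  by apply: boundW1 => //; rewrite (le_trans _ Ww)// leeDl// ltW.
by apply: boundW2 => //; rewrite (le_trans _ Ww)// leeDr.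
Qed.

(** In [C = A * (A + 1)], the factor [A] cancels the pointwise constant. As [q >= 1], the factor
    [A + 1] yields at least [(A + 1)^-1] of gain after taking the power, which beats the integral of
    [W], at most [A]. *)
Lemma modular_frac_integral_le : exists2 C : R, 0 < C &
  forall g : X -> R, measurable_fun setT g -> (forall y, 0 <= g y) ->
    (\int[mu]_y (g y `^ p y)%:E <= 1)%E ->
    (\int[mu]_x (((C^-1)%:E * \int[mu]_y (g y * kernel x y)%:E)
       `^ ((p x)^-1 - eta)^-1) <= 1)%E.
Proof.
have [A A0 major] := frac_integral_majorant.
exists (A * (A + 1)) => [|g mg g0 gp]; first by rewrite mulr_gt0// addr_gt0.
have [W [mW W0 intW boundW]] := major g mg g0 gp.
have A10 : 0 < A + 1 by rewrite addr_gt0.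
apply: (@le_trans _ _ (\int[mu]_x (((A + 1)^-1)%:E * W x))%E); last first.
  rewrite ge0_integralZl_EFin//; last 2 first.
  - by move=> x _; exact: ltW.
  - by rewrite invr_ge0 ltW.
  rewrite lee_pdivrMl// mule1 (le_trans intW)// lee_fin; lra.
apply: ge0_le_integralT => x; first exact: poweR_ge0.
have := W0 x; have := boundW x; case: (W x) => [w|_ _|//]; last first.
  by rewrite gt0_muley ?leey// lte_fin invr_gt0.
move=> /(_ w)/[swap]; rewrite lte_fin => w0 /(_ w0 (lexx _)).
set I := (\int[mu]_y _)%E.
have I0 : (0 <= I)%E.
  by apply: integral_ge0 => y _; rewrite lee_fin mulr_ge0// invr_ge0 powR_ge0.
have /andP[eta0 eta1] := heta; have /andP[sp pp] := hp x; have s1' := s1.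
have iq0 : 0 < (p x)^-1 - eta.
  rewrite subr_gt0 -[ltLHS]invrK ltf_pV2 ?posrE ?invr_gt0//.
  exact: le_lt_trans pMeta.
have iq1 : (p x)^-1 - eta <= 1.
  have : (p x)^-1 <= 1 by rewrite invf_le1//; lra.
  lra.
clearbody I; case: I I0 => // r; rewrite !lee_fin => r0 rA.
set k := (p x)^-1 - eta in iq0 iq1 rA *.
apply: (@le_trans _ _ (((A + 1)^-1 * w `^ k) `^ k^-1)).
  rewrite ge0_ler_powR ?nnegrE ?invr_ge0 ?(ltW iq0)//.
  - by rewrite mulr_ge0// invr_ge0 mulr_ge0 ?(ltW A10) ?(ltW A0).
  - by rewrite mulr_ge0 ?powR_ge0// invr_ge0 ltW.
  rewrite invfM -mulrA [leLHS]mulrCA ler_pM2l ?invr_gt0//.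
  by rewrite ler_pdivrMl.
rewrite powRM ?powR_ge0 ?invr_ge0 ?(ltW A10)//.
rewrite -(powRrM w) divff ?gt_eqF// powRr1 ?(ltW w0)// ler_wpM2r ?(ltW w0)//.
rewrite -powR_inv1 ?(ltW A10)// -powRrM; apply: ler_powR; first lra.
by rewrite mulN1r lerN2 invf_ge1.
Qed.

End bounded.

(** * From the modular to the norm *)

Lemma modular_EFin (R : realType) (disp : measure_display)
    (X : measurableType disp) (mu : {measure set X -> \bar R}) (p : X -> R)
    (f : X -> \bar R) :
  modular mu (EFin \o p) f = (\int[mu]_x (`|f x| `^ p x))%E.
Proof.
rewrite /modular (_ : Omega_infty _ = set0); last first.
  by rewrite -subset0 => x.
by rewrite setC0 patch_set0 Lnorm0// adde0.
Qed.

Section norm.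
Context (R : realType) (disp : measure_display) (X : measurableType disp).
Context (dist : X -> X -> R) (mu : {measure set X -> \bar R}).
Context (hR : reverse_doubling_space dist mu).
Context (x0 : X) (eta s pM : R) (p q : X -> R).
Context (heta : 0 < eta < 1) (s1 : 1 < s) (pMeta : pM < eta^-1).
Context (hp : forall x, s <= p x <= pM) (mp : measurable_fun setT p).
Context (hLH : LH dist x0 p) (hq : forall x, 1 / p x - 1 / q x = eta).
Local Notation m := (ball_measure dist mu).
Local Notation kernel x y := ((m x (dist x y) `^ (1 - eta))^-1).
Let hX := rds_homogeneous hR.

Let p0 x : 0 < p x.
Proof.
by have /andP[? _] := hp x; apply: lt_le_trans _ (lt_trans ltr01 s1) _.
Qed.

Lemma frac_integral_bounded : exists2 C : R, 0 < C & forall f : X -> \bar R,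
  vLebesgue mu (EFin \o p) f ->
  (vnorm mu (EFin \o q) (frac_integral dist mu eta f)
     <= C%:E * vnorm mu (EFin \o p) f)%E.
Proof.
have [C C0 bound] := modular_frac_integral_le hR heta s1 pMeta hp mp hLH.
exists C => // f [mf _].
rewrite -lee_pdivrMl//; apply: le_ereal_inf_tmp => _ [l [l0 fl] <-].
rewrite lee_pdivrMl//; apply: ereal_inf_lbound; exists (C * l) => //.
split; first by rewrite mulr_gt0.
rewrite modular_EFin; rewrite modular_EFin in fl.
have qE x : q x = ((p x)^-1 - eta)^-1.
  by have := hq x; rewrite !div1r => <-; rewrite opprB addrC subrK invrK.
(* The modular bound is for real-valued functions; a modular at most 1 confines the infinite values
   of [f] to a null set. *)
pose N := [set y | (`|f y| = +oo)%E].
have mN : measurable N.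
  have mabs : measurable_fun setT (abse \o f) by exact: measurableT_comp.
  by rewrite -[N]setTI; exact: (mabs measurableT _ (emeasurable_set1 +oo%E)).
have N0 : mu N = 0.
  have : (\int[mu]_(y in N) cst +oo y <= 1)%E.
    apply: le_trans fl; rewrite integral_mkcond; apply: ge0_le_integralT => y.
      by rewrite patchE; case: ifP => _; [exact: leey|exact: lexx].
    rewrite patchE; case: ifPn => [/set_mem|_]; last exact: poweR_ge0.
    rewrite /N/= /scale_inv abseM => ->.
    rewrite gt0_mulye ?lte_fin ?normr_gt0 ?invr_eq0 ?gt_eqF//.
    by rewrite /= gt_eqF.
  rewrite integral_cst//; case: (ltgtP 0%E (mu N)) => // [muN|muN].
    by rewrite gt0_mulye.
  by move: (measure_ge0 mu N); rewrite leNgt muN.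
pose g y := `|fine (f y)| / l.
have mg : measurable_fun setT g.
  apply: measurable_funM => //; apply: measurableT_comp => //.
  exact: measurableT_comp.
have g0 y : 0 <= g y by rewrite divr_ge0// ltW.
have gp : (\int[mu]_y (g y `^ p y)%:E <= 1)%E.
  apply: le_trans fl; apply: ge0_le_integralT => y.
    by rewrite lee_fin powR_ge0.
  rewrite /scale_inv /g; case: (f y) => [r| |].
  - by rewrite -EFinM /= normrM (gtr0_norm (_ : 0 < l^-1)) ?invr_gt0.
  - by rewrite gt0_mulye ?lte_fin ?invr_gt0//= gt_eqF// leey.
  - by rewrite gt0_mulNye ?lte_fin ?invr_gt0//= gt_eqF// leey.
apply: le_trans (bound g mg g0 gp); apply: ge0_le_integralT => x.
  exact: poweR_ge0.
rewrite -qE.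
have mk := measurable_kernel hR eta x.
have k0 y : 0 <= kernel x y by rewrite invr_ge0 powR_ge0.
have mkE : measurable_fun setT (fun y => (kernel x y)%:E).
  exact/measurable_EFinP.
(* [fine] sends the infinite values of [f] to 0 in [g], so the integrands are compared off the null
   set [N]. *)
have absI : (`|frac_integral dist mu eta f x| <=
    l%:E * \int[mu]_y (g y * kernel x y)%:E)%E.
  apply: le_trans (le_abse_integral mu measurableT _) _.
    exact: emeasurable_funM.
  rewrite -ge0_integralZ_EFin ?(ltW l0)//; last 2 first.
  - exact: measurable_funM.
  - by move=> y; rewrite mulr_ge0.
  apply: ae_ge0_le_integral => //.
  - by apply: measurableT_comp => //; exact: emeasurable_funM.
  - by move=> y _; rewrite lee_fin; apply: mulr_ge0; [exact: ltW|exact: mulr_ge0].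
  - apply/measurable_EFinP; apply: measurable_funM => //.
    exact: measurable_funM.
  exists N; split => // y /=; apply: contra_notP => yN _.
  rewrite abseM; have ffin : f y \is a fin_num by move: yN; rewrite /N/=; case: (f y).
  rewrite /g -(fineK ffin) /= -EFinM lee_fin (ger0_norm (k0 _)).
  by rewrite mulrA [l * _]mulrC divfK// gt_eqF.
have q0 : 0 <= q x.
  rewrite qE invr_ge0 subr_ge0 -[leLHS]invrK lef_pV2 ?posrE ?invr_gt0//.
    by rewrite ltW// (le_lt_trans _ pMeta)//; case/andP: (hp x).
  by have /andP[] := heta.
have I0 : (0 <= \int[mu]_y (g y * kernel x y)%:E)%E.
  by apply: integral_ge0 => y _; rewrite lee_fin mulr_ge0.
apply: gt0_ler_poweR => //.
- by rewrite in_itv/= leey andbT abse_ge0.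
- by rewrite in_itv/= leey andbT mule_ge0// lee_fin invr_ge0 ltW.
rewrite /scale_inv abseM; have Cl0 : 0 < (C * l)^-1 by rewrite invr_gt0 mulr_gt0.
rewrite [(`|_%:E|)%E]gee0_abs ?lee_fin ?(ltW Cl0)// muleC.
apply: (@le_trans _ _ ((C * l)^-1%:E * (l%:E * \int[mu]_y (g y * kernel x y)%:E)))%E.
  by rewrite lee_pmul2l.
by rewrite muleA -EFinM invfM -mulrA mulVf ?mulr1// gt_eqF.
Qed.

End norm.

(** * Pointwise bounds on the exponent and the case of finite measure *)

Section exponent.
Context (R : realType) (disp : measure_display) (X : measurableType disp).
Context (dist : X -> X -> R) (mu : {measure set X -> \bar R}).
Context (hR : reverse_doubling_space dist mu).
Let hX := rds_homogeneous hR.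

Lemma LH0_opp (u : X -> R) : LH0 dist u -> LH0 dist (fun x => - u x).
Proof.
by move=> [C hu]; exists C => x y xy xy2; rewrite -opprD normrN; exact: hu.
Qed.

(** The essential bounds on the exponent hold almost everywhere only, while the estimates above use
    them at every point. *)
Lemma LH0_ae_bounds (u : X -> R) (a b : R) : LH0 dist u ->
  {ae mu, forall x, a <= u x <= b} -> forall x, a <= u x <= b.
Proof.
move=> hu uab x; apply/andP; split.
  rewrite -lerN2; apply: (LH0_ae_le hX (LH0_opp hu)).
  by apply: filterS uab => y /andP[? _]; rewrite lerN2.
by apply: (LH0_ae_le hX hu); apply: filterS uab => y /andP[].
Qed.

Lemma LH_of_inv_LH0 (x0 : X) (p : X -> R) (s pM : R) : 0 < s ->
  (forall x, s <= p x <= pM) -> (mu [set: X] < +oo)%E ->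
  LH0 dist (fun x => 1 / p x) -> LH dist x0 p.
Proof.
move=> s0 hp muX [C hC].
have p0 x : 0 < p x by case/andP: (hp x) => ? _; exact: lt_le_trans s0 _.
have pM0 : 0 < pM by case/andP: (hp x0) => ?; exact: lt_le_trans (p0 x0).
have pdiff x y : `|p x - p y| <= pM ^+ 2 * `|1 / p x - 1 / p y|.
  have -> : p x - p y = p x * p y * (1 / p y - 1 / p x).
    by field; rewrite !gt_eqF.
  rewrite normrM distrC ler_wpM2r// gtr0_norm ?mulr_gt0// expr2.
  by rewrite ler_pM ?(ltW (p0 _))//; [case/andP: (hp x)|case/andP: (hp y)].
split.
  exists (pM ^+ 2 * C) => x y xy d2; apply: (le_trans (pdiff x y)).
  by rewrite -[in leRHS]mulrN -[leRHS]mulrA ler_pM2l ?exprn_gt0// hC.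
have muB r : 0 < r -> ball_measure dist mu x0 r <= fine (mu [set: X]).
  move=> _; rewrite -lee_fin -(ball_measureE hX) fineK ?ge0_fin_numE//.
  by rewrite le_measure// ?inE//; exact: (measurable_qball hX).
have [r r0 xr] := bounded_of_ball_measure_le hR muB.
(* On a bounded space the denominator in [LH_infty] is bounded, so a bound on [p] suffices, with 0
   as limit value. *)
exists (pM * ln (expR 1 + r)), 0 => x.
have d0 : 0 <= dist x x0 by exact: (dist_ge0 hX).
have e0 : 0 < expR 1 :> R by exact: expR_gt0.
have lnd : 1 <= ln (expR 1 + dist x x0) by apply: ln_ge1; rewrite lerDl.
rewrite subr0 gtr0_norm// ler_pdivlMr; last by rewrite (lt_le_trans _ lnd).
have /andP[_ pp] := hp x; apply: ler_pM => //; first exact: ltW.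
  by rewrite (le_trans _ lnd).
rewrite ler_ln ?posrE; [|by rewrite ltr_wpDr|exact: addr_gt0].
by rewrite lerD2l ltW// (dist_sym hX).
Qed.
End exponent.

Unset Implicit Arguments.
Theorem theorem1p3 (R : realType) (disp : measure_display)
    (X : measurableType disp) (dist : X -> X -> R)
    (mu : {measure set X -> \bar R})
    (hX : reverse_doubling_space dist mu) (x0 : X)
    (eta : R) (heta0 : 0 < eta) (heta1 : eta < 1)
    (p : X -> R) (hpm : measurable_fun [set: X] p) (hp1 : forall x, 1 <= p x)
    (hpminus : (1 < ess_inf mu (EFin \o p))%E)
    (hpminusplus : (ess_inf mu (EFin \o p) <= ess_sup mu (EFin \o p))%E)
    (hpplus : (ess_sup mu (EFin \o p) < (1 / eta)%:E)%E)
    (q : X -> R) (hq : forall x, 1 / p x - 1 / q x = eta) :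
  (LH dist x0 p ->
     exists2 C : R, 0 < C & forall f : X -> \bar R,
       vLebesgue mu (EFin \o p) f ->
       (vnorm mu (EFin \o q) (frac_integral dist mu eta f)
          <= C%:E * vnorm mu (EFin \o p) f)%E)
  /\
  ((mu [set: X] < +oo)%E -> LH0 dist (fun x => 1 / p x) ->
     exists2 C : R, 0 < C & forall f : X -> \bar R,
       vLebesgue mu (EFin \o p) f ->
       (vnorm mu (EFin \o q) (frac_integral dist mu eta f)
          <= C%:E * vnorm mu (EFin \o p) f)%E).
Proof.
have pI : {ae mu, forall x, (ess_inf mu (EFin \o p) <= (p x)%:E)%E} by exact: ess_inf_le.
have pS : {ae mu, forall x, ((p x)%:E <= ess_sup mu (EFin \o p))%E} by exact: ess_sup_ge.
have [pM [pMeta pS' pMS]] : exists pM, [/\ pM < eta^-1,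
    {ae mu, forall x, p x <= pM} & ess_sup mu (EFin \o p) = pM%:E].
  case: (ess_sup mu (EFin \o p)) pS hpplus hpminusplus => [b pS hb _|//|_ _ hab].
    by exists b; split => //; rewrite -div1r -lte_fin.
  by move: hpminus; rewrite ltNge (le_trans hab) ?leNye.
have [s [s1 pI' sM]] : exists s, [/\ 1 < s, {ae mu, forall x, s <= p x} & s <= pM].
  case: (ess_inf mu (EFin \o p)) pI hpminus hpminusplus => [b pI hb|_ _|_ //].
    by rewrite pMS lee_fin => bM; exists b; split.
  by rewrite pMS leye_eq.
have heta : 0 < eta < 1 by rewrite heta0.
have ae_p : {ae mu, forall x, s <= p x <= pM}.
  by apply: filterS2 pI' pS' => x -> ->.
have p0 x : 0 < p x by exact: lt_le_trans ltr01 (hp1 x).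
split=> [hLH|muX hLH0].
  have hp := LH0_ae_bounds hX hLH.1 ae_p.
  exact: (frac_integral_bounded hX heta s1 pMeta hp hpm hLH hq).
have s0 : 0 < s by exact: lt_trans s1.
have pM0 : 0 < pM by exact: lt_le_trans sM.
(* Only [1 / p] is known to be log-Hoelder here, so the bounds are made pointwise for [1 / p] and
   then inverted. *)
have hp x : s <= p x <= pM.
  have ae_ip : {ae mu, forall x, pM^-1 <= 1 / p x <= s^-1}.
    apply: filterS ae_p => y /andP[sy yM].
    by rewrite div1r !lef_pV2 ?posrE// yM.
  have := LH0_ae_bounds hX hLH0 ae_ip x.
  by rewrite div1r !lef_pV2 ?posrE// andbC.
have hLH := LH_of_inv_LH0 hX x0 s0 hp muX hLH0.
exact: (frac_integral_bounded hX heta s1 pMeta hp hpm hLH hq).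
Qed.
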